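(* There is a universal constant $D_o$ such that the following holds. Assume (A1)--(A3), and let $f:[0,\tau]\times\mathcal{Z}\to\mathbb{R}$ be measurable with $\|f\|_\infty\le M$, where $M>0$. Then for every $n\ge1$ and $\eta>0$, $$P\left(\frac{\sqrt n\,H_\tau\hat G_\tau}{M}\left|\hat\mu_n(f)-\mu(f)\right|\ge 3\sqrt{\frac{\eta}{2}}+\frac{D_o}{2}\right)\le\frac92 e^{-\eta}.$$
   Context: Let $\tau>0$ be a finite constant and $\mathcal{Z}\subset\mathbb{R}^d$. $T$ is a failure time, $Z$ is a random vector with values in $\mathcal{Z}$, and $C\ge 0$ is a censoring time. Put $U=\min\{T,C\}$ and $\delta=\mathbf{1}\{T\le C\}$. The observed data are $(U_i,\delta_i,Z_i)$, $i=1,\dots,n$, i.i.d. copies of $(U,\delta,Z)$, with underlying $T_i,C_i$. $P$ denotes probability and also expectation. $S(t)=P(T>t)$, $G(t)=P(C>t)$, $H(t)=P(U>t)$; for a function $g$, $g(t-)$ is its left limit at $t$. Assumptions: (A1) the pair $(T,Z)$ is independent of $C$. (A2) $T$ takes values in $[0,\tau]$, and $H(\tau-)=P(U\ge\tau)>0$. (A3) $P(T=C)=0$. Kaplan--Meier estimator of $G$ (product over distinct observed times $s\le t$ among the $U_i$): $\hat G_n(t)=\prod_{s\le t}\left(1-\frac{\#\{i:U_i=s,\delta_i=0\}}{\#\{i:U_i\ge s\}}\right)$. Notation: $H_\tau=H(\tau-)=P(U\ge\tau)$, $\hat G_\tau=\hat G_n(\tau-)$. $\mu(f)=P[f(T,Z)]$,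 and $\hat\mu_n(f)=\frac1n\sum_{i=1}^n\frac{\delta_i f(T_i,Z_i)}{\hat G_n(T_i-)}$ (terms with $\delta_i=0$ are zero; when $\delta_i=1$, $T_i=U_i$). ''Universal'' means not depending on $n,\eta,M,f$ or the distributions of $T,Z,C$. In the paper $D_o$ is the constant in the Dvoretzky--Kiefer--Wolfowitz-type inequality for the Kaplan--Meier estimator (Bitouzé, Laurent, Massart 1999): $P(\sqrt n\,S(\tau-)\,\|\hat G_n-G\|_\infty\ge\varepsilon)\le\frac52e^{-2\varepsilon^2+D_o\varepsilon}$ for all $n\ge1$, $\varepsilon>0$ (supremum over $[0,\tau]$). *)

(* Defs.v *)
From mathcomp Require Import all_boot all_order all_algebra.
From mathcomp Require Import all_classical all_reals all_analysis.

Set Implicit Arguments.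
Unset Strict Implicit.
Unset Printing Implicit Defensive.
Import Order.TTheory GRing.Theory Num.Theory.
Import numFieldNormedType.Exports.
Local Open Scope classical_set_scope.
Local Open Scope ring_scope.

Definition left_lim (R : realType) (g : R -> R) (t : R) : R :=
  lim (g x @[x --> t^'-]).

(* Trace measurability: unlike [measurable_fun D f], which holds vacuously
   when [D] is not measurable, this is meaningful for every [D]. *)
Definition trace_measurable d1 d2 (E : measurableType d1)
    (F : measurableType d2) (D : set E) (f : E -> F) : Prop :=
  forall Y : set F, measurable Y -> strace measurable D (D `&` f @^-1` Y).

Section Probability.
Context d (Omega : measurableType d) (R : realType) (P : probability Omega R).

Definition survival (X : Omega -> R) (t : R) : R :=
  fine (P [set w | t < X w]).

Definition indep_pair d1 d2 (E1 : measurableType d1) (E2 : measurableType d2)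
    (X : Omega -> E1) (Y : Omega -> E2) : Prop :=
  forall (A : set E1) (B : set E2), measurable A -> measurable B ->
    P (X @^-1` A `&` Y @^-1` B) = (P (X @^-1` A) * P (Y @^-1` B))%E.

Definition mutually_indep d1 (E : measurableType d1) (I : finType)
    (X : I -> Omega -> E) : Prop :=
  forall (J : {set I}) (B : I -> set E), (forall i, measurable (B i)) ->
    P (\bigcap_(i in [set` J]) X i @^-1` B i)
    = (\prod_(i in J) P (X i @^-1` B i))%E.

Definition same_law d1 (E : measurableType d1) (X Y : Omega -> E) : Prop :=
  forall B : set E, measurable B -> P (X @^-1` B) = P (Y @^-1` B).

Definition iid_copies d1 (E : measurableType d1) (I : finType)
    (X : I -> Omega -> E) (X0 : Omega -> E) : Prop :=
  mutually_indep X /\ forall i, same_law (X i) X0.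

End Probability.

Section RandomCensoring.
Context (Omega : Type) (R : realType) (dim : nat).

Definition obs_time (T C : Omega -> R) (w : Omega) : R := Num.min (T w) (C w).

Definition uncensored (T C : Omega -> R) (w : Omega) : bool := T w <= C w.

Definition observation (T C : Omega -> R) (Z : Omega -> dim.-tuple R)
    (w : Omega) : R * bool * dim.-tuple R :=
  (obs_time T C w, uncensored T C w, Z w).

End RandomCensoring.

Section Estimators.
Context (R : realType) (n : nat).

(* Kaplan-Meier estimator of the censoring survival function, from the
   observed times [u] and the indicators [delta] (true = uncensored); [undup]
   makes the product range over distinct observed times. *)
Definition KM_cens (u : 'I_n -> R) (delta : 'I_n -> bool) (t : R) : R :=
  \prod_(s <- undup [seq u i | i : 'I_n] | s <= t)
    (1 - #|[pred i | (u i == s) && ~~ delta i]|%:R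
         / #|[pred i | s <= u i]|%:R).

Context (Omega : Type) (dim : nat).

Definition Ghat (T C : 'I_n -> Omega -> R) (w : Omega) : R -> R :=
  KM_cens (fun i => obs_time (T i) (C i) w) (fun i => uncensored (T i) (C i) w).

Definition muhat (T C : 'I_n -> Omega -> R) (Z : 'I_n -> Omega -> dim.-tuple R)
    (f : R * dim.-tuple R -> R) (w : Omega) : R :=
  n%:R^-1 * \sum_(i < n | uncensored (T i) (C i) w)
              f (T i w, Z i w) / left_lim (Ghat T C w) (T i w).

End Estimators.

(* Main.v *)
Require Import Defs.
From HB Require Import structures.
From mathcomp Require Import all_boot all_order all_algebra.
From mathcomp Require Import all_classical all_reals all_analysis.
From mathcomp Require Import measurable_realfun perm.
From mathcomp Require Import ring lra.

Set Implicit Arguments.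
Unset Strict Implicit.
Unset Printing Implicit Defensive.
Import Order.TTheory GRing.Theory Num.Theory.
Import numFieldNormedType.Exports.
Local Open Scope classical_set_scope.
Local Open Scope ring_scope.

(* The constant D_o = 0 works, and no DKW-type inequality is needed. On a
   product space carrying n independent copies of (T, Z, C), permuting the
   censoring times among the individuals does not change the law of the sample.
   Fix the (T_i, Z_i) and the ordered censoring times and average over the
   permutations: at each censoring the censored individual is uniform in the
   risk set, and the Kaplan-Meier estimator redistributes its weight equally
   over the others at risk, so that the weighted mean is a martingale started
   at the uncensored mean of the f(T_i, Z_i). With f normalized by M, a jump
   to the value g of the Kaplan-Meier estimator has proxy variance
   1 / (n g)^2, and the number at risk is at most n times the estimator, so the
   proxy variances n / (n g)^2 of sqrt n times the jumps sum up to at most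
   2 (1 / G - 1), where G is the final value. The uncensored mean contributes
   1 more. Exponentiating with parameter s, on the event where G times the
   scaled error exceeds s the exponent is at least
   s^2 / G - s^2 (1 / G - 1) - s^2 / 2 = s^2 / 2, whence the tail bound
   2 exp (- s^2 / 2); at s = 3 sqrt (eta / 2) this is 2 exp (- 9 eta / 4). *)

(** * Hoeffding's lemma *)

Lemma ge0_is_derive_homo (R : realType) (f f' : R -> R) :
  (forall x : R, is_derive x (1:R) f (f' x)) -> (forall x, 0 <= x -> 0 <= f' x) ->
  forall x, 0 <= x -> f 0 <= f x.
Proof.
move=> df f'0 x x0.
have dfx z : derivable f z (1:R) by case: (df z).
apply: (@ger0_derive1_ndecry R f 0 _ _ _ 0 x) => //.
- by move=> z /[!in_itv]/= /andP[z0 _]; rewrite derive1E derive_val f'0 ?ltW.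
- by apply: derivable_within_continuous => z _.
Qed.

Lemma is_derive_div (R : realType) (u v : R -> R) (x u' v' : R) : v x != 0 ->
  is_derive x (1:R) u u' -> is_derive x (1:R) v v' ->
  is_derive x (1:R) (fun y => u y / v y) ((u' * v x - u x * v') / v x ^+ 2).
Proof.
move=> v0 du dv.
have dV := is_deriveV v0 dv.
have -> : (fun y => u y / v y) = u * (fun y => (v y)^-1) by [].
apply: (is_derive_eq (is_deriveM du dV)).
by rewrite /GRing.scale/=; field.
Qed.

Lemma is_derive_ln_comp (R : realType) (v : R -> R) (x v' : R) : 0 < v x ->
  is_derive x (1:R) v v' -> is_derive x (1:R) (fun y => ln (v y)) (v' / v x).
Proof.
move=> v0 dv.
have -> : (fun y => ln (v y)) = (@ln R) \o v by [].
rewrite [v' / _]mulrC.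
exact: (is_derive1_comp (is_derive1_ln v0) dv).
Qed.

Section hoeffding.
Context (R : realType).
Implicit Types (m x y : R).

(** For [-1 <= m <= 1], [D m] is twice the moment generating function of the law on [{-1, 1}] with
    mean [m]; [N m] is its derivative, and differentiating once more gives [D m] back. *)
Let D m x : R := (1 + m) * expR x + (1 - m) * expR (- x).
Let N m x : R := (1 + m) * expR x - (1 - m) * expR (- x).

Let D_gt0 m x : -1 <= m <= 1 -> 0 < D m x.
Proof.
move=> /andP[m0 m1]; rewrite /D; have := expR_gt0 x; have := expR_gt0 (- x).
by nra.
Qed.

Let is_derive_D m x : is_derive x (1:R) (D m) (N m x).
Proof.
apply: is_derive_eq; rewrite /N /GRing.scale/=.
ring.
Qed.

Let is_derive_N m x : is_derive x (1:R) (N m) (D m x).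
Proof.
apply: is_derive_eq; rewrite /D /GRing.scale/=.
ring.
Qed.

(** The logarithm of the left side has slope [N m z / D m z], which is [m] at 0 and has derivative
    [1 - (N m z / D m z) ^+ 2], at most 1. Integrating twice from 0, through the monotonicity of [k]
    and then of [g], gives the quadratic bound. *)
Lemma two_point_mgf_le m x : -1 <= m <= 1 ->
  (1 + m) / 2 * expR x + (1 - m) / 2 * expR (- x) <= expR (m * x + x ^+ 2 / 2).
Proof.
(* Negating both [m] and [x] exchanges the two summands. *)
wlog x0 : m x / 0 <= x => [h m1|m1].
  have [x0|x0] := leP 0 x; first exact: h.
  have := h (- m) (- x); rewrite !opprK mulrNN sqrrN oppr_ge0 ltW// => /(_ isT).
  by rewrite addrC; apply; lra.
have Dgt0 z := @D_gt0 m z m1.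
have D0 z : D m z != 0 by rewrite gt_eqF.
pose k z : R := m + z - N m z / D m z.
pose g z : R := m * z + z ^+ 2 / 2 - ln (D m z).
have dk z : is_derive z (1:R) k ((N m z / D m z) ^+ 2).
  have dq := is_derive_div (D0 z) (is_derive_N m z) (is_derive_D m z).
  have -> : k = (cst m + id) - (fun y => N m y / D m y) by [].
  apply: (is_derive_eq (is_deriveB (is_deriveD (is_derive_cst m z (1:R))
    (is_derive_id z (1:R))) dq)).
  by field.
have k0 z : 0 <= z -> 0 <= k z.
  move=> z0; apply: le_trans (ge0_is_derive_homo dk (fun z _ => sqr_ge0 _) z0).
  rewrite /k /N /D oppr0 expR0 !mulr1 addr0.
  have -> : 1 + m + (1 - m) = 2 by ring.
  have -> : 1 + m - (1 - m) = m * 2 by ring.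
  by rewrite mulfK// subrr.
have dg z : is_derive z (1:R) g (k z).
  have dl := is_derive_ln_comp (Dgt0 z) (is_derive_D m z).
  have -> : g = (m \*: id + (2^-1 \*: (id ^+ 2))) - (fun y => ln (D m y)).
    by apply/funext => y; rewrite /g [y ^+ 2 / 2]mulrC.
  apply: (is_derive_eq (is_deriveB (is_deriveD
    (is_deriveZ m (is_derive_id z (1:R)))
    (is_deriveZ 2^-1 (is_deriveX 2 (is_derive_id z (1:R))))) dl)).
  rewrite /k /GRing.scale/=.
  by field.
have := ge0_is_derive_homo dg k0 x0.
rewrite /g mulr0 expr0n/= mul0r add0r sub0r.
rewrite {1}/D oppr0 expR0 !mulr1.
have -> : 1 + m + (1 - m) = 2 by ring.
move=> h.
have : ln (D m x / 2) <= m * x + x ^+ 2 / 2.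
  by rewrite lnM ?posrE// ?lnV ?posrE//; lra.
rewrite -ler_expR lnK ?posrE ?divr_gt0//; apply: le_trans.
by rewrite /D; lra.
Qed.

Lemma expR_le_two_point x y : -1 <= y <= 1 ->
  expR (x * y) <= (1 + y) / 2 * expR x + (1 - y) / 2 * expR (- x).
Proof.
move=> /andP[y0 y1].
have t0 : 0 <= (1 + y) / 2 by lra.
have t1 : (1 + y) / 2 <= 1 by lra.
have /= := convex_expR (Itv01 t0 t1) x (- x).
rewrite !convRE/= /unstable.onem.
have -> : 1 - (1 + y) / 2 = (1 - y) / 2 by field.
by have -> : (1 + y) / 2 * x + (1 - y) / 2 * - x = x * y by field.
Qed.
End hoeffding.

(** The affine function is the chord of [y |-> expR (x * y)] over [[-B, B]]: it lies above by
    convexity, and its values are two-point moment generating functions. As its coefficients do not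
    depend on [y], it can be averaged by linearity, in finite sums as well as in integrals. *)
Lemma hoeffding_affine (R : realType) (x B : R) : 0 < B ->
  exists a b : R, forall y, `|y| <= B ->
    expR (x * y) <= a + b * y <= expR (x * y + x ^+ 2 * B ^+ 2 / 2).
Proof.
move=> B0; exists ((expR (x * B) + expR (- (x * B))) / 2).
exists ((expR (x * B) - expR (- (x * B))) / (2 * B)) => y.
rewrite ler_norml => /andP[yB1 yB2].
have yB : -1 <= y / B <= 1.
  by rewrite ler_pdivlMr// mulN1r yB1 ler_pdivrMr// mul1r yB2.
have B1 : B != 0 by rewrite gt_eqF.
have e1 : x * y = x * B * (y / B) by field.
have -> : (expR (x * B) + expR (- (x * B))) / 2 +
    (expR (x * B) - expR (- (x * B))) / (2 * B) * y =
    (1 + y / B) / 2 * expR (x * B) + (1 - y / B) / 2 * expR (- (x * B)).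
  by field.
rewrite {1}e1 expR_le_two_point//= (le_trans (two_point_mgf_le _ yB))//.
by rewrite ler_expR e1 exprMn [x * B * _]mulrC.
Qed.

(** Hoeffding's lemma for the uniform law on [A], without normalization: averaging the chord
    replaces [f i] by the mean [m], where the upper bound of the chord applies. *)
Lemma hoeffding_sum (R : realType) (I : finType) (A : pred I) (f : I -> R)
    (x B m : R) : 0 < B -> (forall i, A i -> `|f i| <= B) ->
  \sum_(i | A i) f i = #|A|%:R * m ->
  \sum_(i | A i) expR (x * (m - f i)) <= #|A|%:R * expR (x ^+ 2 * B ^+ 2 / 2).
Proof.
move=> B0 fB fm; have [a [b ab]] := hoeffding_affine (- x) B0.
have [A0|A0] := eqVneq #|A| 0%N.
  by rewrite A0 mul0r big_pred0// => i; have /card0_eq/(_ i) := A0.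
have cA : 0 < #|A|%:R :> R by rewrite ltr0n lt0n.
have mB : `|m| <= B.
  rewrite -(ler_pM2l cA) -{1}[#|A|%:R]gtr0_norm// -normrM -fm.
  rewrite (le_trans (ler_norm_sum _ _ _))// (le_trans (ler_sum _ fB))//.
  by rewrite sumr_const mulr_natl.
rewrite (@le_trans _ _ (\sum_(i | A i) expR (x * m) * (a + b * f i)))//.
  apply: ler_sum => i Ai; rewrite mulrBr expRD ler_pM2l ?expR_gt0//.
  by rewrite -mulNr; case/andP : (ab _ (fB _ Ai)).
rewrite -big_distrr/= big_split/= -big_distrr/= fm sumr_const -[a *+ _]mulr_natl.
rewrite [b * _]mulrCA -mulrDr mulrCA ler_pM2l//.
have /andP[_ abm] := ab _ mB.
rewrite (@le_trans _ _
  (expR (x * m) * expR (- x * m + (- x) ^+ 2 * B ^+ 2 / 2)))//.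
  by rewrite ler_pM2l ?expR_gt0.
by rewrite -expRD addrA mulNr subrr add0r sqrrN.
Qed.

(** * Random censoring with fixed lifetimes *)

(** This conditions on the individual [j] placed at the first position, for the induction over the
    censorings. *)
Lemma sum_lift_perm (V : nmodType) n (F : 'S_n.+1 -> V) :
  \sum_s F s = \sum_j \sum_(s : 'S_n) F (lift_perm ord0 j s).
Proof.
rewrite pair_big/=.
pose h (p : 'I_n.+1 * 'S_n) := lift_perm ord0 p.1 p.2.
rewrite (reindex h)//; apply: onW_bij; apply: inj_card_bij.
  move=> [j s] [j' s'] /permP e.
  have jj' : j = j' by have := e ord0; rewrite /h !lift_perm_id.
  rewrite -jj' in e *; congr pair; apply/permP => k.
  by have := e (lift ord0 k); rewrite /h !lift_perm_lift => /lift_inj.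
by rewrite card_prod !card_Sn card_ord factS.
Qed.

Section redistribution.
Context (R : realType).

(* Position [k] carries the lifetime [a k] and the censoring time [c k]; with
   [c] nondecreasing, [n_at_risk a c k] is the number of individuals at risk
   just before the [k]-th censoring, ties between censorings being broken by
   the position. *)
Definition n_at_risk n (a c : 'I_n -> R) (k : 'I_n) : nat :=
  #|[pred l : 'I_n | (k <= l)%N && (c k < a l)]|.

Definition cens_factor n (a c : 'I_n -> R) (k : 'I_n) : R :=
  if c k < a k then 1 - (n_at_risk a c k)%:R^-1 else 1.

(** The inequality is strict: for sorted [c] this is the left limit at [x] of the Kaplan-Meier
    estimator, see [left_lim_KM_sorted]. *)
Definition cens_surv n (a c : 'I_n -> R) (x : R) : R :=
  \prod_(k | c k < x) cens_factor a c k.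

Definition cens_surv_end n (a c : 'I_n -> R) : R := \prod_k cens_factor a c k.

Definition ipcw_sum n (a f c : 'I_n -> R) : R :=
  \sum_(k | a k <= c k) f k / cens_surv a c (a k).

Let tl n (a : 'I_n.+1 -> R) : 'I_n -> R := a \o lift ord0.

(** A risk set counts only positions from [k] on, so dropping position 0 leaves it unchanged; the
    recursions below follow. *)
Lemma n_at_risk_lift n (a c : 'I_n.+1 -> R) (k : 'I_n) :
  n_at_risk a c (lift ord0 k) = n_at_risk (tl a) (tl c) k.
Proof.
rewrite /n_at_risk -!sum1_card !big_mkcond/= big_ord_recl/=.
by rewrite add0n [RHS]big_mkcond; apply: eq_bigr => l _; rewrite !inE.
Qed.

Lemma cens_factor_lift n (a c : 'I_n.+1 -> R) (k : 'I_n) :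
  cens_factor a c (lift ord0 k) = cens_factor (tl a) (tl c) k.
Proof. by rewrite /cens_factor n_at_risk_lift. Qed.

Lemma cens_surv_end_recl n (a c : 'I_n.+1 -> R) :
  cens_surv_end a c = cens_factor a c ord0 * cens_surv_end (tl a) (tl c).
Proof.
rewrite /cens_surv_end big_ord_recl; congr (_ * _).
by apply: eq_bigr => k _; rewrite cens_factor_lift.
Qed.

Lemma cens_surv_recl n (a c : 'I_n.+1 -> R) x :
  cens_surv a c x = (if c ord0 < x then cens_factor a c ord0 else 1) *
    cens_surv (tl a) (tl c) x.
Proof.
rewrite /cens_surv big_mkcond big_ord_recl; congr (_ * _).
by rewrite [RHS]big_mkcond; apply: eq_bigr => k _; rewrite cens_factor_lift.
Qed.

Lemma cens_surv_le n (a c : 'I_n -> R) x : (forall k, x <= c k) ->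
  cens_surv a c x = 1.
Proof. by move=> xc; rewrite /cens_surv big_pred0// => k; rewrite ltNge xc. Qed.

(** Position 0, if uncensored, has weight 1 because no censoring precedes it. Its factor is moved
    from the weights of the remaining lifetimes into their values: this is the redistribution of the
    censored weight. *)
Lemma ipcw_sum_recl n (a f c : 'I_n.+1 -> R) : (forall k, c ord0 <= c k) ->
  ipcw_sum a f c = (if a ord0 <= c ord0 then f ord0 else 0) +
    ipcw_sum (tl a) (fun k => f (lift ord0 k) /
      (if c ord0 < a (lift ord0 k) then cens_factor a c ord0 else 1)) (tl c).
Proof.
move=> c0; rewrite /ipcw_sum big_mkcond big_ord_recl; congr (_ + _).
  case: ifPn => // ac; rewrite cens_surv_le ?divr1// => k.
  exact: le_trans (c0 k).
rewrite [RHS]big_mkcond; apply: eq_bigr => k _; rewrite cens_surv_recl.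
by rewrite invfM mulrA.
Qed.

Lemma cens_factor_ge0 n (a c : 'I_n -> R) k : 0 <= cens_factor a c k.
Proof.
rewrite /cens_factor; case: ifPn => // ck; rewrite subr_ge0 invf_le1 ?ler1n ?ltr0n//.
  by apply/card_gt0P; exists k; rewrite inE leqnn.
by apply/card_gt0P; exists k; rewrite inE leqnn.
Qed.

Lemma cens_surv_end_ge0 n (a c : 'I_n -> R) : 0 <= cens_surv_end a c.
Proof. by apply: prodr_ge0 => k _; exact: cens_factor_ge0. Qed.

(** The arrangement decides who stands at the first censoring, but not how many are at risk
    there. *)
Lemma n_at_risk0_perm n (t c : 'I_n.+1 -> R) (s : 'S_n.+1) :
  n_at_risk (t \o s) c ord0 = #|[pred i | c ord0 < t i]|.
Proof.
rewrite /n_at_risk -!sum1_card [RHS](reindex_inj (@perm_inj _ s))/=.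
by apply: eq_bigl => l; rewrite !inE.
Qed.

Lemma card_lift n (Q : pred 'I_n.+1) j :
  (Q j + #|[pred k | Q (lift j k)]| = #|Q|)%N.
Proof.
rewrite -!sum1_card [RHS]big_mkcond (bigD1_ord j)//= [in LHS]big_mkcond/=.
by rewrite -[j \in Q]/(Q j); case: (Q j).
Qed.

(* Induction on the number of censorings still to come: [N] is the original
   sample size, [b] the current inverse survival weight (already included in the
   [f i] of those at risk), and an individual is at risk if [lo < t i]. The
   weight of the censored individual is redistributed equally over the others at
   risk; Hoeffding's lemma for the uniform choice of that individual is absorbed
   by the increase of [b]. *)
Lemma ipcw_sum_mgf (lam N : R) n (t f c : 'I_n -> R) (lo b : R) : 0 < b ->
  {homo c : k l / (k <= l)%N >-> k <= l} -> (forall k, lo <= c k) ->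
  (forall i, lo < t i -> `|f i| <= b) ->
  #|[pred i | lo < t i]|%:R * b <= N ->
  \sum_(s : 'S_n) (if 0 < cens_surv_end (t \o s) c then
    expR (lam * (ipcw_sum (t \o s) (f \o s) c - \sum_i f i)
          - lam ^+ 2 * N * b / cens_surv_end (t \o s) c) else 0)
  <= n`!%:R * expR (- (lam ^+ 2 * N * b)).
Proof.
elim: n t f c lo b => [|n IH] t f c lo b b0 cmono loc fb Nb.
  rewrite (eq_bigr (fun=> expR (- (lam ^+ 2 * N * b)))).
    by rewrite sumr_const card_Sn mulr_natl.
  move=> s _; rewrite /cens_surv_end /ipcw_sum !big_ord0 ltr01 subrr mulr0.
  by rewrite divr1 sub0r.
rewrite sum_lift_perm.
pose A := [pred i | c ord0 < t i].
pose Y := #|A|.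
pose E := expR (- (lam ^+ 2 * N * b)).
pose S := \sum_(i | A i) f i.
pose g : R := 1 - Y%:R^-1.
pose x := lam / g.
(* Up to the factor [n!], [W j] bounds the sum over the arrangements with [j] at the first
   censoring. If [j] is not at risk, the bound stays [E]; if [j] alone is at risk, the final value
   is 0 and the terms vanish; otherwise [b] becomes [b / g] and the sum of the values moves by
   [(S / Y - f j) / g]. *)
pose W j := if A j then if Y == 1%N then 0 else
  expR (x * (S / Y%:R - f j)) * expR (- (lam ^+ 2 * N * (b / g))) else E.
have c0 k : c ord0 <= c k by exact: cmono.
have alo i : A i -> lo < t i by move=> /(le_lt_trans (loc ord0)).
have YN : Y%:R * b <= N.
  apply: le_trans Nb; rewrite ler_pM2r// ler_nat; apply: subset_leq_card.
  by apply/fintype.subsetP => i; rewrite !inE; exact: alo.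
have facE j (s : 'S_n) : cens_factor (t \o lift_perm ord0 j s) c ord0 =
    if A j then g else 1.
  by rewrite /cens_factor/= lift_perm_id n_at_risk0_perm.
have tlE (h : 'I_n.+1 -> R) j (s : 'S_n) :
    tl (h \o lift_perm ord0 j s) = (h \o lift j) \o s.
  by apply/funext => k; rewrite /tl/= lift_perm_lift.
have sumW : \sum_j W j <= n.+1%:R * E.
  rewrite (bigID A)/= addrC.
  rewrite (eq_bigr (fun=> E)); last by move=> j Aj; rewrite /W /= (negbTE Aj).
  have -> : \sum_(j | ~~ A j) E = (n.+1%:R - Y%:R) * E.
    rewrite sumr_const -[E *+ _]mulr_natl; congr (_ * _).
    rewrite -[X in X%:R - _](card_ord n.+1) -(cardC A) natrD addrAC subrr add0r.
    by congr (_%:R).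
  rewrite -[leRHS](subrK (Y%:R * E)) -[in leRHS]mulrBl lerD2l.
  have [Y1|Y1] := eqVneq Y 1%N.
    rewrite big1 ?mulr_ge0 ?expR_ge0//.
    by move=> j Aj; rewrite /W /= Aj Y1.
  have [Y0|Y0] := eqVneq Y 0%N.
    rewrite big_pred0 ?mulr_ge0 ?expR_ge0//.
    by move=> j; have /card0_eq/(_ j) := Y0; rewrite inE.
  have Y2 : 2 <= Y%:R :> R by rewrite (ler_nat R 2); case: (Y) Y0 Y1 => [|[]].
  rewrite (eq_bigr (fun j => expR (x * (S / Y%:R - f j)) *
      expR (- (lam ^+ 2 * N * (b / g))))); last first.
    by move=> j Aj; rewrite /W /= Aj (negbTE Y1).
  rewrite -big_distrl/=.
  have := @hoeffding_sum R _ A f x b (S / Y%:R) b0.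
  move=> /(_ (fun i Ai => fb i (alo i Ai))).
  have Yn0 : Y%:R != 0 :> R by rewrite pnatr_eq0.
  rewrite mulrCA mulfV// mulr1 => /(_ erefl) hS.
  apply: le_trans (ler_wpM2r (expR_ge0 _) hS) _.
  rewrite -[leLHS]mulrA ler_pM2l; last by rewrite ltr0n lt0n.
  rewrite -expRD ler_expR /x.
  have gE : g = (Y%:R - 1) / Y%:R by rewrite mulrBl mulfV// mul1r.
  have Y1' : Y%:R - 1 != 0 :> R by rewrite gt_eqF//; lra.
  (* Since [b / g - b = b / (Y - 1)], the gain in the exponent is [lam ^+ 2 * N * (b / (Y - 1))]. It
     absorbs Hoeffding's term because [Y * b <= N] and [Y <= 2 * (Y - 1)] for [Y >= 2]. *)
  have -> : - (lam ^+ 2 * N * b) =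
    lam ^+ 2 * N * (b / (Y%:R - 1)) - lam ^+ 2 * N * (b / g).
    by rewrite gE; field; rewrite Y1' Yn0.
  rewrite lerD2r.
  have -> : (lam / g) ^+ 2 * b ^+ 2 / 2 =
    lam ^+ 2 * (b / (Y%:R - 1)) * (Y%:R ^+ 2 * b / (2 * (Y%:R - 1))).
    by rewrite gE; field; rewrite Y1' Yn0.
  rewrite [leRHS]mulrAC ler_wpM2l//.
    by rewrite mulr_ge0 ?sqr_ge0// divr_ge0//; lra.
  rewrite ler_pdivrMr; last by lra.
  have N0 : 0 <= N by apply: le_trans YN; rewrite mulr_ge0// ltW.
  rewrite (@le_trans _ _ (N * Y%:R))//.
    by rewrite expr2 -mulrA mulrC ler_wpM2r.
  by rewrite ler_wpM2l//; lra.
have {}IH j : \sum_(s : 'S_n)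
    (if 0 < cens_surv_end (t \o lift_perm ord0 j s) c then
    expR (lam * (ipcw_sum (t \o lift_perm ord0 j s)
                   (f \o lift_perm ord0 j s) c - \sum_i f i)
          - lam ^+ 2 * N * b / cens_surv_end (t \o lift_perm ord0 j s) c) else 0)
    <= n`!%:R * W j.
  rewrite /W; case: ifPn => Aj; last first.
    (* The failure of [j] is observed with its current weight, so [f j] cancels between the weighted
       and the plain sum. *)
    apply: le_trans (IH (t \o lift j) (f \o lift j) (c \o lift ord0) (c ord0) b
      b0 _ _ _ _).
    - apply: ler_sum => s _.
      have facj : cens_factor (t \o lift_perm ord0 j s) c ord0 = 1.
        by rewrite facE (negbTE Aj).
      rewrite cens_surv_end_recl facj mul1r !tlE ipcw_sum_recl// facj.
      rewrite /= lift_perm_id [t j <= _]leNgt (Aj : ~~ (c ord0 < t j)).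
      rewrite (bigD1_ord j)//=.
      set p1 := ipcw_sum _ _ _; set p2 := ipcw_sum _ _ _.
      have -> : p1 = p2.
        congr (ipcw_sum _ _ _); apply/funext => k;
          by rewrite /tl/= ?if_same ?divr1 lift_perm_lift.
      by rewrite opprD addrACA subrr add0r.
    - by move=> k l kl; apply: cmono; rewrite /= leq_add2l.
    - by move=> k; exact: c0.
    - by move=> i Ai; apply: fb; exact: alo.
    - apply: le_trans YN; rewrite ler_pM2r// ler_nat.
      by rewrite /Y -(card_lift A j) leq_addl.
  have [Y1|Y1] := eqVneq Y 1%N.
    rewrite mulr0 big1// => s _.
    by rewrite cens_surv_end_recl facE Aj /g Y1 invr1 subrr mul0r ltxx.
  have Y0 : Y != 0%N by apply/eqP => /card0_eq/(_ j); rewrite inE => /negP; exact.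
  have Y2 : 2 <= Y%:R :> R by rewrite (ler_nat R 2); case: (Y) Y0 Y1 => [|[]].
  have Yn0 : Y%:R != 0 :> R by rewrite pnatr_eq0.
  have gE : g = (Y%:R - 1) / Y%:R by rewrite mulrBl mulfV// mul1r.
  have Y1' : Y%:R - 1 != 0 :> R by rewrite gt_eqF//; lra.
  have g0 : 0 < g by rewrite gE divr_gt0//; lra.
  pose f' i := f i / (if A i then g else 1).
  have {}IH := IH (t \o lift j) (f' \o lift j) (c \o lift ord0) (c ord0) (b / g).
  (* The martingale increment: it has mean zero for [j] uniform in [A]. *)
  have sumf' : \sum_k f' (lift j k) - \sum_i f i = (S / Y%:R - f j) / g.
    have -> : \sum_k f' (lift j k) = \sum_i f' i - f' j.
      by rewrite (bigD1_ord j)//= addrAC subrr add0r.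
    rewrite (bigID A)/= [\sum_i f i](bigID A)/=.
    have -> : \sum_(i | ~~ A i) f' i = \sum_(i | ~~ A i) f i.
      by apply: eq_bigr => i Ai; rewrite /f' ifN// divr1.
    have -> : \sum_(i | A i) f' i = S / g.
      by rewrite /S mulr_suml; apply: eq_bigr => i Ai; rewrite /f' ifT.
    have -> : f' j = f j / g by rewrite /f' ifT.
    rewrite -/S gE; move: (\sum_(i | ~~ A i) f i) => q.
    by field; rewrite Yn0 Y1'.
  rewrite (eq_bigr (fun s : 'S_n => expR (x * (S / Y%:R - f j)) *
      (if 0 < cens_surv_end ((t \o lift j) \o s) (c \o lift ord0) then
       expR (lam * (ipcw_sum ((t \o lift j) \o s) ((f' \o lift j) \o s)
         (c \o lift ord0) - \sum_i (f' \o lift j) i) -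
       lam ^+ 2 * N * (b / g) /
       cens_surv_end ((t \o lift j) \o s) (c \o lift ord0)) else 0))).
    rewrite -big_distrr/= [leRHS]mulrCA ler_wpM2l ?expR_ge0// IH//.
    - by rewrite divr_gt0.
    - by move=> k l kl; apply: cmono; rewrite /= leq_add2l.
    - by move=> k; exact: c0.
    - move=> i /= Ai; rewrite /f' /= Ai normrM normfV (gtr0_norm g0).
      by rewrite ler_pM2r ?invr_gt0//; apply: fb; exact: alo.
    (* One individual fewer is at risk and the weight bound is divided by [g]:
       [(Y - 1) * (b / g) = Y * b], so the bound by [N] persists. *)
    - apply: le_trans YN.
      have YE : Y = #|[pred i | c ord0 < (t \o lift j) i]|.+1.
        by rewrite /Y -(card_lift A j) Aj.
      rewrite YE; set q := #|_|; have YEr : Y%:R = q%:R + 1 :> R by rewrite YE natr1.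
      move: Y1' Yn0; rewrite gE YEr addrK => q0 q1.
      rewrite le_eqVlt; apply/orP; left; apply/eqP.
      by rewrite -natr1; field; rewrite q0 q1.
  move=> s _; rewrite cens_surv_end_recl facE Aj !tlE ipcw_sum_recl// facE Aj.
  rewrite pmulr_rgt0//; case: ifPn => [G0|]; last by rewrite mulr0.
  rewrite -expRD; congr expR.
  rewrite /= lift_perm_id leNgt (Aj : c ord0 < t j) /= add0r.
  set p1 := ipcw_sum _ _ _; set p2 := ipcw_sum _ _ _.
  have -> : p1 = p2.
    by congr (ipcw_sum _ _ _); apply/funext => k; rewrite /tl/= lift_perm_lift.
  have -> : \sum_i f i = \sum_k f' (lift j k) - (S / Y%:R - f j) / g.
    by rewrite -sumf' opprB addrC subrK.
  rewrite /x; field.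
  by apply/and3P; split=> //; exact: lt0r_neq0.
rewrite (le_trans (ler_sum _ (fun j _ => IH j)))// -big_distrr/=.
by rewrite factS natrM [n.+1%:R * _]mulrC -[leRHS]mulrA ler_pM2l// ltr0n fact_gt0.
Qed.

End redistribution.

(** * Counting the permutations with a large deviation *)

Section deviation.
Context (R : realType) (n : nat).
Implicit Types t f c : 'I_n -> R.

Lemma ipcw_sumN t f c : ipcw_sum t (\- f) c = - ipcw_sum t f c.
Proof. by rewrite /ipcw_sum -sumrN; apply: eq_bigr => k _; rewrite mulNr. Qed.

(** Markov's inequality for the exponential moment in [ipcw_sum_mgf], with [lam = s / sqrt n],
    [N = n] and [b = 1]. With [q = sqrt n], final value [G] and weighted sum [D], the exponent at a
    counted permutation is [s / G * (q * G * (D / n - mu) - s)], hence nonnegative. *)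
Let card_upper_deviation t f c (mu s : R) : (0 < n)%N -> 0 < s ->
  {homo c : k l / (k <= l)%N >-> k <= l} -> (forall i, `|f i| <= 1) ->
  #|[pred p : 'S_n | s <= Num.sqrt n%:R * cens_surv_end (t \o p) c *
      (n%:R^-1 * ipcw_sum (t \o p) (f \o p) c - mu)]|%:R <=
  n`!%:R * (expR (- s ^+ 2) *
    expR (s / Num.sqrt n%:R * (\sum_i f i - n%:R * mu))).
Proof.
move=> n0 s0 cmono f1.
have nR0 : 0 < n%:R :> R by rewrite ltr0n.
have q0 : 0 < Num.sqrt n%:R :> R by rewrite sqrtr_gt0.
have qq : Num.sqrt n%:R ^+ 2 = n%:R :> R by rewrite sqr_sqrtr// ltW.
set q := Num.sqrt n%:R in q0 qq *.
pose K : R := expR (s / q * (\sum_i f i - n%:R * mu)).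
(* Any lower bound of the censoring times will do: all values are bounded by 1 and at most [n]
   individuals are at risk. *)
pose lo : R := \big[Order.min/0]_k c k.
have loc k : lo <= c k by exact: bigmin_le_cond.
have N1 : #|[pred i | lo < t i]|%:R * 1 <= n%:R :> R.
  by rewrite mulr1 ler_nat -[leqRHS]card_ord max_card.
have := ipcw_sum_mgf (s / q) ltr01 cmono loc (fun i _ => f1 i) N1.
have -> : (s / q) ^+ 2 * n%:R = s ^+ 2.
  by rewrite -qq expr_div_n divfK// sqrf_eq0 gt_eqF.
rewrite -(ler_pM2l (expR_gt0 (s / q * (\sum_i f i - n%:R * mu)))) big_distrr/=.
rewrite mulr1 mulrCA [_ * expR (- _)]mulrC; apply: le_trans.
rewrite -sum1_card natr_sum big_mkcond/=; apply: ler_sum => p _.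
rewrite inE; case: ifPn => [sG|_]; last first.
  by rewrite mulr_ge0 ?expR_ge0//; case: ifPn => // _; rewrite expR_ge0.
have G0 : 0 < cens_surv_end (t \o p) c.
  rewrite lt0r cens_surv_end_ge0 andbT; apply: contraTneq sG => ->.
  by rewrite mulr0 mul0r -ltNge.
rewrite G0 -expRD -[leLHS]expR0 ler_expR.
move: sG; set G := cens_surv_end _ _ in G0 *; set D := ipcw_sum _ _ _ => sG.
have -> : s / q * (\sum_i f i - n%:R * mu) + (s / q * (D - \sum_i f i) -
   s ^+ 2 / G) = s / G * (q * G * (n%:R^-1 * D - mu) - s).
  rewrite -qq; field.
  by rewrite !gt_eqF.
by rewrite mulr_ge0 ?subr_ge0// divr_ge0// ltW.
Qed.

Lemma card_deviation t f c (mu s : R) : (0 < n)%N -> 0 < s ->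
  {homo c : k l / (k <= l)%N >-> k <= l} -> (forall i, `|f i| <= 1) ->
  #|[pred p : 'S_n | s <= Num.sqrt n%:R * cens_surv_end (t \o p) c *
      `|n%:R^-1 * ipcw_sum (t \o p) (f \o p) c - mu| ]|%:R <=
  n`!%:R * (expR (- s ^+ 2) *
    (expR (s / Num.sqrt n%:R * (\sum_i f i - n%:R * mu)) +
     expR (- (s / Num.sqrt n%:R) * (\sum_i f i - n%:R * mu)))).
Proof.
move=> n0 s0 cmono f1.
have h1 := card_upper_deviation t mu n0 s0 cmono f1.
have := @card_upper_deviation t (\- f) c (- mu) s n0 s0 cmono.
have -> : \sum_i (\- f) i - n%:R * - mu = - (\sum_i f i - n%:R * mu).
  by rewrite sumrN; ring.
rewrite mulrN => h2.
have {}h2 := h2 (fun i => eq_ind_r (fun x => x <= 1) (f1 i) (normrN (f i))).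
rewrite (mulrDr (expR _)) (mulrDr n`!%:R) mulNr; apply: le_trans (lerD h1 h2).
rewrite -natrD ler_nat -cardUI (leq_trans _ (leq_addr _ _))//.
apply: subset_leq_card; apply/fintype.subsetP => p; rewrite !inE.
rewrite (_ : (\- f) \o p = \- (f \o p)) // ipcw_sumN mulrN.
set x := _ - mu; have [x0|x0] := leP 0 x.
  by rewrite ger0_norm// => ->.
by rewrite ltr0_norm// opprB opprK [mu - _]addrC => ->; rewrite orbT.
Qed.

End deviation.

(** * The Kaplan-Meier estimator *)

Section kaplan_meier.
Context (R : realType) (n : nat).
Implicit Types (u : 'I_n -> R) (delta : 'I_n -> bool).

Definition KM_factor u delta (s : R) : R :=
  1 - #|[pred i | (u i == s) && ~~ delta i]|%:R / #|[pred i | s <= u i]|%:R.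

(** The estimator is constant between the last observed time before [x] and [x] itself. *)
Lemma left_lim_KM u delta x : left_lim (KM_cens u delta) x =
  \prod_(s <- undup [seq u i | i : 'I_n] | s < x) KM_factor u delta s.
Proof.
apply: cvg_lim => //; apply: cvg_near_cst.
have : \forall y \near x^'-, y < x /\
    \big[andb/true]_(s <- undup [seq u i | i : 'I_n] | s < x) (s < y).
  near=> y; split; first by near: y; exact: nbhs_left_lt.
  near: y; elim: (undup _) => [|s r IH].
    by apply: nearW => y; rewrite big_nil.
  case: (ltP s x) => sx.
    near=> y; rewrite big_cons sx; apply/andP; split.
      by near: y; exact: nbhs_left_gt.
    by near: y.
  near=> y; rewrite big_cons ltNge sx/=.
  by near: y.
apply: filterS => y [yx]; rewrite big_all_cond => /allP ys.
rewrite /KM_cens big_seq_cond [RHS]big_seq_cond; apply: eq_bigl => s.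
case: (boolP (s \in _)) => //= sin; apply/idP/idP => [sy|sx].
  exact: le_lt_trans yx.
by have /implyP/(_ sx)/ltW := ys _ sin.
Unshelve. all: by end_near. Qed.

Lemma KM_cens_perm u delta (p : 'S_n) :
  KM_cens (u \o p) (delta \o p) = KM_cens u delta.
Proof.
apply/funext => x; rewrite /KM_cens.
rewrite (perm_big (undup [seq u i | i : 'I_n])); last first.
  apply/perm_undup => s; apply/mapP/mapP => -[i _ ->].
    by exists (p i) => //; exact: mem_enum.
  by exists (p^-1%g i); [exact: mem_enum|rewrite /= permKV].
apply: eq_bigr => s _; congr (1 - _%:R / _%:R).
  rewrite -!sum1_card [RHS](reindex_inj (@perm_inj _ p))/=.
  by apply: eq_bigl => i; rewrite !inE.
rewrite -!sum1_card [RHS](reindex_inj (@perm_inj _ p))/=.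
by apply: eq_bigl => i; rewrite !inE.
Qed.

(** The product telescopes: removing the elements of [A] one by one from [Y] individuals gives
    [(Y - 1) / Y], then [(Y - 2) / (Y - 1)], and so on. The subtracted cardinal is the rank of [i]
    in [A]. *)
Lemma prod_rank (A : pred 'I_n) (Y : R) : #|A|%:R <= Y ->
  \prod_(i | A i) (1 - (Y - #|[pred j : 'I_n | (j < i)%N && A j]|%:R)^-1) =
  1 - #|A|%:R / Y.
Proof.
move=> AY.
pose cnt k := #|[pred j : 'I_n | (j < k)%N && A j]|.
have cntS (i : 'I_n) : A i -> cnt i.+1 = (cnt i).+1.
  move=> Ai; rewrite /cnt (cardD1 i) inE/= ltnSn Ai add1n; congr _.+1.
  apply: eq_card => j; rewrite !inE ltnS ltn_neqAle andbA.
  by congr (_ && _ && _).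
suff key k : (k <= n)%N -> \prod_(i | A i && (i < k)%N)
    (1 - (Y - (cnt i)%:R)^-1) = 1 - (cnt k)%:R / Y.
  have := key n (leqnn n).
  rewrite (eq_bigl A) => [->|i]; last by rewrite ltn_ord andbT.
  by congr (1 - _%:R / _); apply: eq_card => j; rewrite !inE ltn_ord.
elim: k => [_|k IH kn].
  rewrite big_pred0 => [|i]; last by rewrite andbF.
  by rewrite /cnt eq_card0 ?mul0r ?subr0// => i; rewrite !inE.
pose i := Ordinal kn.
have [Ai|Ai] := boolP (A i).
  rewrite (bigD1 i)/=; last by rewrite Ai/=.
  rewrite (eq_bigl (fun j => A j && (j < k)%N)); last first.
    move=> j; rewrite ltnS -andbA; congr (_ && _).
    by rewrite ltn_neqAle andbC.
  rewrite IH 1?ltnW// (cntS i Ai) /= -natr1.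
  have cY : (cnt k)%:R + 1 <= Y.
    apply: le_trans AY; rewrite natr1 -(cntS i Ai) ler_nat.
    apply: subset_leq_card; apply/fintype.subsetP => j.
    by rewrite !inE => /andP[].
  have c0 : 0 <= (cnt k)%:R :> R by [].
  by field; rewrite !gt_eqF//; lra.
rewrite (eq_bigl (fun j => A j && (j < k)%N)); last first.
  move=> j; case: (boolP (A j)) => //= Aj; rewrite ltnS leq_eqVlt.
  case: eqP => //= jk; have ji : j = i by exact: val_inj.
  by rewrite -ji Aj in Ai.
rewrite IH 1?ltnW//; congr (1 - _%:R / _); apply: eq_card => j; rewrite !inE.
case: (boolP (A j)) => Aj; last by rewrite !andbF.
rewrite !andbT ltnS [RHS]leq_eqVlt.
case: eqP => //= jk; have ji : j = i by exact: val_inj.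
by rewrite -ji Aj in Ai.
Qed.

Definition KM_index_factor u delta (i : 'I_n) : R :=
  1 - (#|[pred j | u i <= u j]|%:R -
    #|[pred j : 'I_n | (j < i)%N && ((u j == u i) && ~~ delta j)]|%:R)^-1.

(* Simultaneous censorings, ordered by their index, are removed one at a time. *)
Lemma left_lim_KM_prod u delta x : left_lim (KM_cens u delta) x =
  \prod_(i | (u i < x) && ~~ delta i) KM_index_factor u delta i.
Proof.
rewrite left_lim_KM.
transitivity (\prod_(s <- undup [seq u i | i : 'I_n] | s < x)
  \prod_(i | (u i == s) && ~~ delta i) KM_index_factor u delta i).
  apply: eq_bigr => s _; rewrite /KM_factor.
  rewrite -(@prod_rank (fun i => (u i == s) && ~~ delta i)).
    by apply: eq_bigr => i /andP[/eqP us _]; rewrite /KM_index_factor us.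
  rewrite ler_nat; apply: subset_leq_card; apply/fintype.subsetP => j.
  by rewrite !inE => /andP[/eqP-> _].
rewrite (exchange_big_dep (fun i => (u i < x) && ~~ delta i))/=; last first.
  by move=> s i sx /andP[/eqP-> ->]; rewrite sx.
apply: eq_bigr => i /andP[ux di].
rewrite (eq_bigl (fun s => s == u i)); last first.
  move=> s; rewrite di andbT eq_sym; case: eqP => [->|]; rewrite ?ux ?andbF//.
rewrite big_mkcond (bigD1_seq (u i))/= ?undup_uniq//; last first.
  by rewrite mem_undup; apply/mapP; exists i => //; exact: mem_enum.
by rewrite eqxx big1 ?mulr1// => s /negbTE ->.
Qed.

(** Among the individuals observed at [c k] or later, those at positions before [k] are exactly the
    earlier censorings tied with [k], which the index factor subtracts; those from [k] on are at
    risk when [c k < a j], strictness being harmless as no [a j] equals [c k]. *)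
Lemma left_lim_KM_sorted (a c : 'I_n -> R) x :
  {homo c : k l / (k <= l)%N >-> k <= l} -> (forall k l, a k != c l) ->
  left_lim (KM_cens (fun k => Num.min (a k) (c k)) (fun k => a k <= c k)) x =
  cens_surv a c x.
Proof.
move=> cmono ac; rewrite left_lim_KM_prod /cens_surv.
rewrite big_mkcond [RHS]big_mkcond; apply: eq_bigr => k _.
rewrite -ltNge /cens_factor; have [ck|ck] := ltP (c k) (a k).
  rewrite andbT; case: ifPn => // _.
  rewrite /KM_index_factor/= (min_r (ltW ck)); congr (1 - _^-1).
  rewrite -natrB; last first.
    apply: subset_leq_card; apply/fintype.subsetP => j.
    by rewrite !inE => /and3P[_ /eqP-> _].
  congr (_%:R); rewrite /n_at_risk.
  rewrite -(cardID [pred j : 'I_n | (j < k)%N]) addnC.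
  rewrite (_ : #|[predI _ & _]| =
    #|[pred j : 'I_n | (j < k)%N &&
      ((Num.min (a j) (c j) == c k) && ~~ (a j <= c j))]|).
    rewrite addnK; apply: eq_card => j; rewrite !inE -leqNgt.
    have [kj|//] := leqP k j; rewrite /= le_min cmono//= andbT.
    by rewrite le_eqVlt eq_sym (negbTE (ac _ _)).
  apply: eq_card => j; rewrite !inE andbC; have [jk|//] := ltnP j k.
  rewrite /= le_min -ltNge; have cjk := cmono _ _ (ltnW jk).
  rewrite [c k <= a j]le_eqVlt eq_sym (negbTE (ac _ _))/=.
  apply/andP/andP => [[akj ckj]|[/eqP]].
    have e : c j = c k by apply/le_anti; rewrite ckj cjk.
    by rewrite !e min_r ?(ltW akj).
  move=> + cja; rewrite min_r ?(ltW cja)// => e.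
  by rewrite -e cja lexx.
by rewrite andbF if_same.
Qed.

(** A censoring at or after [x] meets no larger lifetime and has factor 1. With [x = tau], this
    identifies the left limit at [tau] with the final value. *)
Lemma cens_surv_end_le (a c : 'I_n -> R) x : (forall k, a k <= x) ->
  cens_surv a c x = cens_surv_end a c.
Proof.
move=> ax; rewrite /cens_surv big_mkcond; apply: eq_bigr => k _.
rewrite /cens_factor; case: ifPn => // ckx; case: ifPn => // cka.
by rewrite (lt_le_trans cka (ax k)) in ckx.
Qed.

(** The estimator [muhat] as a function of the observed data, symmetric in the individuals. *)
Definition ipcw_mean u delta (v : 'I_n -> R) : R :=
  n%:R^-1 * \sum_(i < n | delta i) v i / left_lim (KM_cens u delta) (u i).

Lemma ipcw_mean_perm u delta v (p : 'S_n) :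
  ipcw_mean (u \o p) (delta \o p) (v \o p) = ipcw_mean u delta v.
Proof.
rewrite /ipcw_mean KM_cens_perm; congr (_ * _).
by rewrite [RHS](reindex_inj (@perm_inj _ p)).
Qed.

Lemma ipcw_mean_sorted (a f c : 'I_n -> R) :
  {homo c : k l / (k <= l)%N >-> k <= l} -> (forall k l, a k != c l) ->
  ipcw_mean (fun k => Num.min (a k) (c k)) (fun k => a k <= c k) f =
  n%:R^-1 * ipcw_sum a f c.
Proof.
move=> cmono ac; congr (_ * _); apply: eq_bigr => k ak.
by rewrite left_lim_KM_sorted// min_l.
Qed.

Lemma exists_sorting_perm (c : 'I_n -> R) :
  exists r : 'S_n, {homo c \o r : k l / (k <= l)%N >-> k <= l}.
Proof.
pose ct := [tuple c i | i < n].
have /tuple_permP[r rE] : perm_eq (sort_tuple <=%R ct) ct by rewrite perm_sort.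
exists r => k l kl /=.
have st : sorted <=%R (sort_tuple <=%R ct) by exact: sort_le_sorted.
have cE i : c (r i) = tnth (sort_tuple <=%R ct) i.
  rewrite (tnth_nth 0) rE.
  have <- : tnth [tuple tnth ct (r i) | i < n] i = c (r i) by rewrite !tnth_mktuple.
  by rewrite (tnth_nth 0).
rewrite !cE !(tnth_nth 0).
by apply: (sorted_leq_nth le_trans le_refl) => //;
  rewrite inE (size_tuple (sort_tuple _ _)).
Qed.

(** By symmetry of the estimators, individuals may be relabelled by [r * p^-1], where [r] sorts [c].
    Permuting the censoring times by [p] thus becomes permuting the lifetimes against sorted
    censoring times, and [p |-> r * p^-1] is injective. *)
Lemma card_ipcw_mean_deviation (t f c : 'I_n -> R) (tau mu s : R) :
  (0 < n)%N -> 0 < s -> (forall k l, t k != c l) -> (forall k, t k <= tau) ->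
  (forall i, `|f i| <= 1) ->
  #|[pred p : 'S_n | let u i := Num.min (t i) (c (p i)) in
      let delta i := t i <= c (p i) in
      s <= Num.sqrt n%:R * left_lim (KM_cens u delta) tau *
        `|ipcw_mean u delta f - mu| ]|%:R <=
  n`!%:R * (expR (- s ^+ 2) *
    (expR (s / Num.sqrt n%:R * (\sum_i f i - n%:R * mu)) +
     expR (- (s / Num.sqrt n%:R) * (\sum_i f i - n%:R * mu)))).
Proof.
move=> n0 s0 tc ttau f1; have [r cmono] := exists_sorting_perm c.
apply: le_trans (card_deviation t mu n0 s0 cmono f1).
rewrite ler_nat -!sum1_card.
have inj_h : injective (fun p : 'S_n => (r * p^-1)%g).
  by move=> p q /mulgI/invg_inj.
rewrite [leqRHS](reindex_inj inj_h)/= eq_leq//; apply: eq_bigl => p.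
rewrite !inE; set q := (r * p^-1)%g.
have qE i : p (q i) = r i by rewrite /q permM permKV.
pose u i := Num.min (t i) (c (p i)).
pose delta i := t i <= c (p i).
have uE : u \o q = (fun k => Num.min ((t \o q) k) ((c \o r) k)).
  by apply/funext => k; rewrite /u/= qE.
have dE : delta \o q = (fun k => (t \o q) k <= (c \o r) k).
  by apply/funext => k; rewrite /delta/= qE.
have tcq k l : (t \o q) k != (c \o r) l by exact: tc.
rewrite -/u -/delta -(KM_cens_perm u delta q) -(ipcw_mean_perm u delta f q).
rewrite uE dE left_lim_KM_sorted// ipcw_mean_sorted// cens_surv_end_le// => k.
exact: ttau.
Qed.

End kaplan_meier.

(** * Measurability and product spaces *)

Section measurability.
Context d (X : measurableType d) (R : realType).

(** Inversion is odd and agrees with the power of exponent -1 on nonnegative reals, including 0,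
    whose inverse is 0. *)
Lemma measurable_funV (f : X -> R) :
  measurable_fun setT f -> measurable_fun setT (fun x => (f x)^-1).
Proof.
move=> mf.
have mp : measurable_fun [set: R] (@powR R ^~ (-1)) by exact: measurable_powR.
rewrite (_ : (fun x => _) = (fun x => if 0 <= f x then f x `^ (-1)
                                      else - ((- f x) `^ (-1)))).
  apply: measurable_fun_ifT; first exact: measurable_fun_ler.
    exact: measurableT_comp mp mf.
  apply: measurableT_comp; first exact: oppr_measurable.
  apply: measurableT_comp mp _; apply: measurableT_comp mf.
  exact: oppr_measurable.
apply/funext => x; case: ifPn => f0; first by rewrite powR_inv1.
by rewrite powR_inv1 ?invrN ?opprK// oppr_ge0 ltW// ltNge.
Qed.

Lemma measurable_card (I : finType) (b : I -> X -> bool) :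
  (forall i, measurable_fun setT (b i)) ->
  measurable_fun setT (fun x => #|[pred i | b i x]|%:R : R).
Proof.
move=> mb; rewrite (_ : (fun x => _) =
    (fun x => \sum_(i <- index_enum I) (if b i x then 1 else 0))).
  by apply: measurable_sum => i; apply: measurable_fun_ifT.
apply/funext => x; rewrite -sum1_card natr_sum big_mkcond; apply: eq_bigr => i _.
by rewrite inE; case: (b i x).
Qed.

Context (n : nat) (u v : 'I_n -> X -> R) (delta : 'I_n -> X -> bool).
Context (mu : forall i, measurable_fun setT (u i))
  (mv : forall i, measurable_fun setT (v i))
  (mdelta : forall i, measurable_fun setT (delta i)).

(** The distinct observed times form a random index set; the product over individuals has a fixed
    one, so measurability is checked factor by factor. *)
Lemma measurable_left_lim_KM (t : X -> R) : measurable_fun setT t ->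
  measurable_fun setT (fun x => left_lim (KM_cens (u ^~ x) (delta ^~ x)) (t x)).
Proof.
move=> mt.
rewrite (_ : (fun x => _) = (fun x => \prod_(i <- index_enum 'I_n)
   (if (u i x < t x) && ~~ delta i x
    then KM_index_factor (u ^~ x) (delta ^~ x) i else 1))); last first.
  by apply/funext => x; rewrite left_lim_KM_prod big_mkcond.
apply: measurable_prod => i _; apply: measurable_fun_ifT => //.
  by apply: measurable_and; [exact: measurable_fun_ltr|exact: measurable_neg].
rewrite /KM_index_factor; apply: measurable_funB => //; apply: measurable_funV.
apply: measurable_funB; apply: measurable_card => j.
  exact: measurable_fun_ler.
apply: measurable_and => //; apply: measurable_and; last exact: measurable_neg.
exact: measurable_fun_eqr.
Qed.

Lemma measurable_ipcw_mean : measurable_fun setT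
  (fun x => ipcw_mean (u ^~ x) (delta ^~ x) (v ^~ x)).
Proof.
apply: measurable_funM => //.
rewrite (_ : (fun x => _) = (fun x => \sum_(i <- index_enum 'I_n)
   (if delta i x then v i x / left_lim (KM_cens (u ^~ x) (delta ^~ x)) (u i x)
    else 0))); last by apply/funext => x; rewrite big_mkcond.
apply: measurable_sum => i; apply: measurable_fun_ifT => //.
apply: measurable_funM => //; apply: measurable_funV.
exact: measurable_left_lim_KM.
Qed.

End measurability.

(** Each sublevel set of [f] at a rational [q] is the trace on [D] of a measurable [B q], and [f] is
    recovered on [D] as the infimum of the [q] with [x] in [B q]. *)
Lemma trace_measurable_extension d (E : measurableType d) (R : realType)
    (D : set E) (f : E -> R) (M : R) :
  trace_measurable D f -> 0 <= M -> (forall x, D x -> `|f x| <= M) ->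
  exists2 g : E -> R, measurable_fun setT g & forall x, D x -> g x = f x.
Proof.
move=> mf M0 fM.
have [B BP] : {B : rat -> set E & forall q, measurable (B q) /\
    B q `&` D = D `&` f @^-1` [set y | y < ratr q]}.
  apply: (@choice _ _ (fun q A => measurable A /\
    A `&` D = D `&` f @^-1` [set y | y < ratr q])) => q.
  have [|A mA AD] := mf [set y | y < ratr q].
    by rewrite -set_itvE; exact: measurable_itv.
  by exists A.
(* The value [M] is the default outside [B q] and for codes of no rational; clamping to [[-M, M]]
   keeps the infimum bounded below. *)
pose h (k : nat) x : R := if unpickle k is Some q then
  if x \in B q then Num.max (- M) (Num.min M (ratr q)) else M else M.
have hM k x : - M <= h k x.
  rewrite /h; case: (unpickle k) => [q|]; last by lra.
  by case: ifP => _; [rewrite le_max lexx|lra].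
exists (fun x => infs (h ^~ x) 0%N).
  apply: measurable_fun_infs => // [x _|k].
    by exists (- M) => _ [k _ <-].
  rewrite /h; case: (unpickle k) => [q|]//.
  apply: measurable_fun_ifT => //; apply: (measurable_fun_bool true).
  rewrite setTI (_ : _ @^-1` _ = B q); first by case: (BP q).
  by apply/seteqP; split => x /=; [exact: set_mem|exact: mem_set].
move=> x Dx; rewrite /infs/=; have fx := fM x Dx.
have BE q : (x \in B q) = (f x < ratr q).
  have [_ BD] := BP q; apply/idP/idP => [|fq].
    rewrite in_setE => Bx.
    by have : (B q `&` D) x by []; rewrite BD => -[].
  by rewrite in_setE; have : (D `&` f @^-1` [set y | y < ratr q]) x by [];
     rewrite -BD => -[].
move: fx; rewrite ler_norml => /andP[Mf fM'].
apply/le_anti/andP; split; last first.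
  apply: lb_le_inf; first by exists (h 0%N x); exists 0%N.
  move=> _ [k _ <-]; rewrite /h; case: (unpickle k) => [q|//].
  by rewrite BE; case: ifPn => // fq; rewrite le_max le_min fM' (ltW fq) orbT.
apply/ler_addgt0Pr => e e0.
have /rat_in_itvoo[q] : f x < f x + e by rewrite ltrDl.
rewrite in_itv/= => /andP[fq qe].
apply: (@le_trans _ _ (h (pickle q) x)); last first.
  rewrite /h pickleK BE fq ge_max ge_min (ltW qe) orbT andbT.
  by apply: le_trans Mf _; rewrite lerDl ltW.
apply: ge_inf; last by exists (pickle q).
by exists (- M) => _ [k _ <-].
Qed.

(** * Laws of finite samples *)

Section tuple_law.
Context d (E : measurableType d) (R : realType) (n : nat).

(** Measurable rectangles are stable under intersection and generate the product sigma-algebra, so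
    they determine the law. *)
Lemma tuple_law_unique d1 d2 (T1 : measurableType d1) (T2 : measurableType d2)
    (P1 : probability T1 R) (P2 : probability T2 R)
    (Y1 : 'I_n -> T1 -> E) (Y2 : 'I_n -> T2 -> E) :
  (forall i, measurable_fun setT (Y1 i)) ->
  (forall i, measurable_fun setT (Y2 i)) ->
  (forall B : 'I_n -> set E, (forall i, measurable (B i)) ->
    P1 [set w | forall i, B i (Y1 i w)] = P2 [set w | forall i, B i (Y2 i w)]) ->
  forall S : set (n.-tuple E), measurable S ->
    P1 [set w | S [tuple Y1 i w | i < n]] = P2 [set w | S [tuple Y2 i w | i < n]].
Proof.
move=> mY1 mY2 PB S mS.
have mF1 : measurable_fun setT (fun w => [tuple Y1 i w | i < n]).
  apply/measurable_fun_tnthP => i.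
  by rewrite (_ : _ \o _ = Y1 i)//; apply/funext => w /=; rewrite tnth_mktuple.
have mF2 : measurable_fun setT (fun w => [tuple Y2 i w | i < n]).
  apply/measurable_fun_tnthP => i.
  by rewrite (_ : _ \o _ = Y2 i)//; apply/funext => w /=; rewrite tnth_mktuple.
pose F1 : {mfun T1 >-> n.-tuple E} := HB.pack (fun w => [tuple Y1 i w | i < n])
  (isMeasurableFun.Build _ _ _ _ _ mF1).
pose F2 : {mfun T2 >-> n.-tuple E} := HB.pack (fun w => [tuple Y2 i w | i < n])
  (isMeasurableFun.Build _ _ _ _ _ mF2).
pose G : set (set (n.-tuple E)) := [set A | exists2 B : 'I_n -> set E,
  forall i, measurable (B i) & A = [set y | forall i, B i (tnth y i)]].
have GT : G setT by exists (fun=> setT) => //; apply/seteqP; split.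
apply: (@measure_unique _ R (n.-tuple E) G (fun=> setT) _ _ _ _
  (distribution P1 F1) (distribution P2 F2)) => //.
- apply/seteqP; split.
    apply: smallest_sub; first exact: smallest_sigma_algebra.
    rewrite -bigcup_seq => A /= -[i /= _].
    rewrite /preimage_set_system/= => -[C mC <-]; apply: sub_sigma_algebra.
    exists (fun j => if j == i then C else setT).
      by move=> j; case: ifP.
    rewrite setTI; apply/seteqP; split => y /= => [Cy j|/(_ i)].
      by case: eqP => // ->.
    by rewrite eqxx.
  apply: smallest_sub; first exact: sigma_algebra_measurable.
  move=> _ [B mB ->].
  rewrite (_ : [set y | _] = \bigcap_(i in setT) ((@tnth n E)^~ i @^-1` B i)).
    apply: fin_bigcap_measurable => // i _; rewrite -[X in measurable X]setTI.
    exact: measurable_tnth.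
  by apply/seteqP; split => y h i; [move=> _|]; exact: h.
- move=> _ _ [B mB ->] [B' mB' ->].
  exists (fun i => B i `&` B' i); first by move=> i; exact: measurableI.
  by apply/seteqP; split => y /=; [move=> [h h'] i|move=> h; split=> i; case: (h i)].
- by rewrite bigcup_const//; exists 0%N.
- move=> _ [B mB ->]; rewrite /distribution /pushforward.
  transitivity (P1 [set w | forall i, B i (Y1 i w)]).
    congr (P1 _).
    by apply/seteqP; split => w h i; move: (h i); rewrite /= tnth_mktuple.
  rewrite PB//; congr (P2 _).
  by apply/seteqP; split => w h i; move: (h i); rewrite /= tnth_mktuple.
- move=> _; rewrite (le_lt_trans (probability_le1 _ _)) ?ltry//.
Qed.

End tuple_law.

(** An iterated product, one factor per copy. The factorization of expectations is carried through
    the induction by Tonelli's theorem; the base case takes the given space, with no copy to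
    build. *)
Lemma exists_iid_copies d (T : measurableType d) (R : realType)
    (P : probability T R) (n : nat) :
  exists (d' : measure_display) (T' : measurableType d')
    (P' : probability T' R) (Y : 'I_n -> T' -> T),
  [/\ forall i, measurable_fun setT (Y i),
    forall B : 'I_n -> set T, (forall i, measurable (B i)) ->
      P' [set w | forall i, B i (Y i w)] = (\prod_i P (B i))%E &
    forall h : T -> R, measurable_fun setT h -> (forall x, 0 <= h x) ->
      (\int[P']_w (\prod_i h (Y i w))%:E = \prod_(i < n) \int[P]_x (h x)%:E)%E].
Proof.
elim: n => [|n [d' [T' [P' [Y [mY PY EY]]]]]].
  exists d, T, P, (fun _ => id); split=> //.
    move=> B mB; rewrite big_ord0 -[RHS](@probability_setT _ _ _ P).
    by congr (P _); apply/seteqP; split => // w _ [].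
  move=> h mh h0; rewrite big_ord0.
  under eq_integral do rewrite big_ord0.
  by rewrite integral_cst// mul1e; exact: probability_setT.
exists _, (T * T')%type, (P \x P')%E.
exists (fun i w => if unlift ord0 i is Some j then Y j w.2 else w.1).
have Y0 w : (if unlift ord0 ord0 is Some j then Y j w.2 else w.1) = w.1 :> T.
  by rewrite unlift_none.
have YS j w : (if unlift ord0 (lift ord0 j) is Some j then Y j w.2 else w.1) =
    Y j w.2 :> T.
  by rewrite liftK.
split.
- move=> i; case: (unlift ord0 i) => [j|]; last exact: measurable_fst.
  exact: measurableT_comp (mY j) measurable_snd.
- move=> B mB.
  rewrite (_ : [set w | _] = B ord0 `*` [set w | forall j, B (lift ord0 j) (Y j w)]).
    have mD : measurable [set w | forall j, B (lift ord0 j) (Y j w)].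
      rewrite (_ : [set w | _] = \bigcap_(j in setT) (Y j @^-1` B (lift ord0 j))).
        apply: fin_bigcap_measurable => // j _; rewrite -[X in measurable X]setTI.
        exact: mY.
      by apply/seteqP; split => y h i; [move=> _|]; exact: h.
    apply: eq_trans (product_measure1E P P' (mB ord0) mD) _.
    rewrite big_ord_recl; congr (_ * _)%E.
    exact: (PY (fun j => B (lift ord0 j))).
  apply/seteqP; split => [w h|w [h0 h] i] /=.
    split=> [|j]; first by have := h ord0; rewrite Y0.
    by have := h (lift ord0 j); rewrite YS.
  by case: (unliftP ord0 i) => [j ->|->]; [exact: h|exact: h0].
- move=> h mh h0.
  have mprod : measurable_fun setT (fun w : T' => \prod_i h (Y i w)).
    by apply: measurable_prod => j _; exact: measurableT_comp mh (mY j).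
  have prod0 w : 0 <= \prod_i h (Y i w) by apply: prodr_ge0 => i _; exact: h0.
  rewrite (eq_integral (fun w => (h w.1)%:E * (\prod_i h (Y i w.2))%:E)%E); last first.
    move=> w _; rewrite -EFinM big_ord_recl Y0; congr ((_ * _)%:E).
    by apply: eq_bigr => j _; rewrite YS.
  rewrite fubini_tonelli1/=; last 2 first.
  - apply: emeasurable_funM; apply/measurable_EFinP.
      exact: measurableT_comp mh measurable_fst.
    exact: measurableT_comp mprod measurable_snd.
  - by move=> w; rewrite mule_ge0// lee_fin.
  rewrite /fubini_F/=.
  transitivity (\int[P]_x ((h x)%:E * \prod_(i < n) \int[P]_x (h x)%:E))%E.
    apply: eq_integral => x _; rewrite -(EY h)// -ge0_integralZl//.
    - exact/measurable_EFinP.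
    - by move=> w _; rewrite lee_fin.
    - by rewrite lee_fin.
  rewrite big_ord_recl ge0_integralZr//.
  - exact/measurable_EFinP.
  - by move=> x _; rewrite lee_fin.
  - rewrite -(EY h)//; apply: integral_ge0 => x _.
    by rewrite lee_fin.
Qed.

(** * Moment generating functions of bounded variables *)

Lemma integral_cst_probability d (T : measurableType d) (R : realType)
  (P : probability T R) (r : R) : (\int[P]_w r%:E = r%:E)%E.
Proof.
rewrite integral_cst// -[RHS]mule1; congr (_ * _)%E.
exact: probability_setT.
Qed.

(** The chord of [hoeffding_affine] with [B = 1] is integrated, which replaces [g] by its mean. *)
Lemma mgf_bounded d (T : measurableType d) (R : realType) (P : probability T R)
    (g : T -> R) (x : R) : measurable_fun setT g -> (forall w, `|g w| <= 1) ->
  (\int[P]_w (expR (x * (g w - fine (\int[P]_w (g w)%:E))))%:E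
   <= (expR (x ^+ 2 / 2))%:E)%E.
Proof.
move=> mg g1.
have ig : P.-integrable setT (EFin \o g).
  apply: measurable_bounded_integrable => //.
    by rewrite (le_lt_trans (probability_le1 _ _)) ?ltry.
  exists 1; split; first exact: num_real.
  by move=> y y1 w _; exact: le_trans (g1 w) (ltW y1).
have icst (r : R) : P.-integrable setT (EFin \o cst r).
  exact: finite_measure_integrable_cst.
set m := fine _.
have mE : (\int[P]_w (g w)%:E = m%:E)%E.
  by rewrite fineK// integrable_fin_num.
have m1 : `|m| <= 1.
  rewrite -lee_fin -[leRHS](integral_cst_probability P).
  rewrite -abse_EFin -mE; apply: le_trans (le_abse_integral _ _ _) _ => //.
    by case/integrableP : ig.
  apply: ge0_le_integral => //.
    apply: measurableT_comp => //; first by case/integrableP : ig.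
  by move=> w _; rewrite abse_EFin lee_fin.
have [a [b ab]] := hoeffding_affine x (@ltr01 R).
have iab : P.-integrable setT (fun w => a%:E + b%:E * (g w)%:E)%E.
  by apply: integrableD => //; [exact: icst|exact: integrableZl].
have mexp : measurable_fun setT (fun w => expR (x * g w)).
  by apply: measurableT_comp => //; exact: measurable_funM.
apply: (@le_trans _ _ ((expR (- (x * m)))%:E * \int[P]_w (expR (x * g w))%:E)%E).
  rewrite -ge0_integralZl//; last exact/measurable_EFinP.
  have -> : (\int[P]_w (expR (x * (g w - m)))%:E =
      \int[P]_w ((expR (- (x * m)))%:E * (expR (x * g w))%:E))%E.
    by apply: eq_integral => w _; rewrite -EFinM -expRD mulrBr addrC.
  exact: lexx.
have -> : (expR (x ^+ 2 / 2))%:E =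
    ((expR (- (x * m)))%:E * (expR (x * m + x ^+ 2 / 2))%:E)%E.
  by rewrite -EFinM -expRD addKr.
rewrite lee_pmul2l// ?lte_fin ?expR_gt0//.
apply: (@le_trans _ _ (\int[P]_w (a%:E + b%:E * (g w)%:E))%E).
  apply: ge0_le_integral => //.
  - exact/measurable_EFinP.
  - by case/integrableP : iab.
  - by move=> w _; rewrite -EFinM -EFinD lee_fin; case/andP : (ab _ (g1 w)).
rewrite integralD//; [|exact: icst|exact: integrableZl].
rewrite integralZl// mE integral_cst_probability -EFinM -EFinD lee_fin.
by have /andP[_] := ab _ m1; rewrite expr1n mulr1.
Qed.

Lemma mgf_sum_bounded d (T : measurableType d) (R : realType)
    (P : probability T R) d' (T' : measurableType d') (P' : probability T' R)
    (n : nat) (Y : 'I_n -> T' -> T) (g : T -> R) (x : R) :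
  (forall h : T -> R, measurable_fun setT h -> (forall x, 0 <= h x) ->
    (\int[P']_w (\prod_i h (Y i w))%:E = \prod_(i < n) \int[P]_x (h x)%:E)%E) ->
  measurable_fun setT g -> (forall w, `|g w| <= 1) ->
  (\int[P']_w (expR (x * (\sum_i g (Y i w) -
     n%:R * fine (\int[P]_w (g w)%:E))))%:E <= (expR (n%:R * (x ^+ 2 / 2)))%:E)%E.
Proof.
move=> EY mg g1; set m := fine _.
pose h w := expR (x * (g w - m)).
rewrite (eq_integral (fun w => (\prod_i h (Y i w))%:E)); last first.
  move=> w _; rewrite /h -expR_sum -mulr_sumr sumrB sumr_const card_ord.
  by rewrite mulr_natl.
rewrite EY//; last first.
- by move=> w; exact: expR_ge0.
- apply: measurableT_comp => //; apply: measurable_funM => //.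
  exact: measurable_funB.
have h0 : (0 <= \int[P]_w (h w)%:E)%E.
  by apply: integral_ge0 => w _; rewrite lee_fin expR_ge0.
have h1 : (\int[P]_w (h w)%:E <= (expR (x ^+ 2 / 2))%:E)%E by exact: mgf_bounded.
rewrite expRM_natl; elim: (n) => [|k IH]; first by rewrite big_ord0.
rewrite big_ord_recl exprS EFinM; apply: lee_pmul => //.
by elim/big_ind : _ => // *; rewrite mule_ge0.
Qed.

(** * Exchangeability of the censoring times *)

Lemma measurable_eqr_set d (T : measurableType d) (R : realType) (f g : T -> R) :
  measurable_fun setT f -> measurable_fun setT g ->
  measurable [set w | f w = g w].
Proof.
move=> mf mg; rewrite -[X in measurable X]setTI.
rewrite (_ : [set w | _] = (fun w => f w == g w) @^-1` [set true]).
  exact: measurable_fun_eqr.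
by apply/seteqP; split => w /= /eqP.
Qed.

Lemma integral_two_sided_le d (T : measurableType d) (R : realType)
    (P : probability T R) (Z : T -> R) (k x a : R) :
  0 <= k -> measurable_fun setT Z ->
  (\int[P]_w (expR (x * Z w))%:E <= a%:E)%E ->
  (\int[P]_w (expR (- x * Z w))%:E <= a%:E)%E ->
  (\int[P]_w (k * (expR (x * Z w) + expR (- x * Z w)))%:E <= (2 * k * a)%:E)%E.
Proof.
move=> k0 mZ h1 h2.
have mE r : measurable_fun setT (fun w => (expR (r * Z w))%:E).
  by apply/measurable_EFinP; apply: measurableT_comp => //; exact: measurable_funM.
have e0 r w : (0 <= (expR (r * Z w))%:E)%E by rewrite lee_fin expR_ge0.
under eq_integral do rewrite EFinM EFinD.
rewrite ge0_integralZl//; last 2 first.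
- exact: emeasurable_funD.
- by move=> w _; rewrite adde_ge0.
rewrite ge0_integralD//.
have -> : (2 * k * a)%:E = (k%:E * (a%:E + a%:E))%E.
  by rewrite -EFinD -EFinM; congr (_%:E); ring.
by apply: lee_wpmul2l; [rewrite lee_fin|exact: leeD].
Qed.

(** The event of the theorem after dividing the values by [M] and moving the constant [H_tau] into
    the threshold [s]. *)
Definition large_deviation (R : realType) (n : nat) (tau mu s : R)
    (u : 'I_n -> R) (delta : 'I_n -> bool) (v : 'I_n -> R) : bool :=
  s <= Num.sqrt n%:R * left_lim (KM_cens u delta) tau *
    `|ipcw_mean u delta v - mu|.

Lemma measurable_large_deviation d (T : measurableType d) (R : realType)
    (n : nat) (tau mu s : R) (u v : 'I_n -> T -> R) (delta : 'I_n -> T -> bool) :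
  (forall i, measurable_fun setT (u i)) ->
  (forall i, measurable_fun setT (v i)) ->
  (forall i, measurable_fun setT (delta i)) ->
  measurable [set w | large_deviation tau mu s (u ^~ w) (delta ^~ w) (v ^~ w)].
Proof.
move=> mu_ mv mdelta.
have mb : measurable_fun setT
    (fun w => large_deviation tau mu s (u ^~ w) (delta ^~ w) (v ^~ w)).
  apply: measurable_fun_ler => //; apply: measurable_funM.
    apply: measurable_funM => //.
    by apply: measurable_left_lim_KM => //; exact: measurable_cst.
  apply: measurableT_comp; first exact: normr_measurable.
  by apply: measurable_funB => //; exact: measurable_ipcw_mean.
by have := mb measurableT [set true] I; rewrite setTI.
Qed.

Section censored_sample.
Context d (T : measurableType d) (R : realType) (P : probability T R).
Context (X : T -> R * R) (C : T -> R).
Context (mX : measurable_fun setT X) (mC : measurable_fun setT C).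
Context (indepXC : indep_pair P X C).
Context d' (T' : measurableType d') (P' : probability T' R).
Context (n : nat) (Y : 'I_n -> T' -> T).
Context (mY : forall i, measurable_fun setT (Y i)).
Context (PY : forall B : 'I_n -> set T, (forall i, measurable (B i)) ->
  P' [set w | forall i, B i (Y i w)] = (\prod_i P (B i))%E).

(* The sample in which the [j]-th censoring time is that of individual [p j],
   as a tuple in which lifetimes and censoring times are separate coordinates:
   measurable rectangles of this tuple split along the independence of [X]
   and [C]. *)
Definition permuted_coord (p : 'S_n) (k : 'I_(n + n)) (w : T') : R * R :=
  match fintype.split k with inl i => X (Y i w) | inr j => (C (Y (p j) w), 0) end.

Lemma measurable_permuted_coord p k : measurable_fun setT (permuted_coord p k).
Proof.
rewrite /permuted_coord; case: (fintype.split k) => i.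
  exact: measurableT_comp mX (mY i).
apply: measurable_fun_pair => //; exact: measurableT_comp mC (mY _).
Qed.

(** Individual [i] supplies its lifetime and the censoring time in slot [p^-1 i]. Independence
    splits its two constraints and reindexing removes [p], so the law does not depend on [p]. *)
Lemma permuted_coord_rect p (B : 'I_(n + n) -> set (R * R)) :
  (forall k, measurable (B k)) ->
  P' [set w | forall k, B k (permuted_coord p k w)] =
  (\prod_i P (X @^-1` B (lshift n i)) *
   \prod_j P (C @^-1` [set c | B (rshift n j) (c, 0%R)]))%E.
Proof.
move=> mB.
pose BC (j : 'I_n) : set R := [set c | B (rshift n j) (c, 0)].
have mBC j : measurable (BC j).
  have mpair : measurable_fun [set: R] (fun c : R => (c, 0 : R)).
    exact: measurable_fun_pair.
  by have := mpair measurableT _ (mB (rshift n j)); rewrite setTI.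
pose D i := X @^-1` B (lshift n i) `&` C @^-1` BC ((p^-1)%g i).
rewrite (_ : [set w | _] = [set w | forall i, D i (Y i w)]); last first.
  apply/seteqP; split => w /= h i.
    split.
      by have := h (lshift n i); rewrite /permuted_coord (unsplitK (inl i)).
    have := h (rshift n ((p^-1)%g i)).
    by rewrite /permuted_coord (unsplitK (inr _)) permKV.
  rewrite /permuted_coord; case: splitP => j ij.
    have -> : i = lshift n j by exact: val_inj.
    by case: (h j).
  have -> : i = rshift n j by exact: val_inj.
  by case: (h (p j)) => _; rewrite /BC/= permK.
have mXB i : measurable (X @^-1` B (lshift n i)).
  by rewrite -[X in measurable X]setTI; exact: mX.
have mCB j : measurable (C @^-1` BC j).
  by rewrite -[X in measurable X]setTI; exact: mC.
rewrite PY; last by move=> i; exact: measurableI.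
rewrite (eq_bigr (fun i => P (X @^-1` B (lshift n i)) *
    P (C @^-1` BC ((p^-1)%g i)))%E); last by move=> i _; exact: indepXC.
rewrite big_split/=; congr (_ * _)%E.
by rewrite [RHS](reindex_inj (@perm_inj _ (p^-1)%g)).
Qed.

Lemma permuted_coord_law p (S : set ((n + n).-tuple (R * R))) : measurable S ->
  P' [set w | S [tuple permuted_coord p k w | k < n + n]] =
  P' [set w | S [tuple permuted_coord 1 k w | k < n + n]].
Proof.
apply: tuple_law_unique => [k|k|B mB]; try exact: measurable_permuted_coord.
by rewrite !permuted_coord_rect.
Qed.

Let tnth_lshift p w i :
  tnth [tuple permuted_coord p k w | k < n + n] (lshift n i) = X (Y i w).
Proof. by rewrite tnth_mktuple /permuted_coord (unsplitK (inl i)). Qed.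

Let tnth_rshift p w j :
  tnth [tuple permuted_coord p k w | k < n + n] (rshift n j) = (C (Y (p j) w), 0).
Proof. by rewrite tnth_mktuple /permuted_coord (unsplitK (inr j)). Qed.

Context (PXC : P [set w | (X w).1 = C w] = 0%E).

(** Exchanging the censoring times of [i] and [j] preserves the law and turns the event into a tie
    within individual [i]. *)
Lemma cross_ties_negligible i j : P' [set w | (X (Y i w)).1 = C (Y j w)] = 0%E.
Proof.
pose S := [set y : (n + n).-tuple (R * R) |
  (tnth y (lshift n i)).1 = (tnth y (rshift n i)).1].
have mS : measurable S.
  by apply: measurable_eqr_set;
    exact: measurableT_comp measurable_fst (measurable_tnth _).
have mD : measurable [set w | (X w).1 = C w].
  apply: measurable_eqr_set => //.
  exact: measurableT_comp measurable_fst mX.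
transitivity (P' [set w | S [tuple permuted_coord (tperm i j) k w | k < n + n]]).
  by congr (P' _); apply/seteqP; split => w; rewrite /S/= tnth_lshift tnth_rshift tpermL.
rewrite permuted_coord_law//.
pose D l := if l == i then [set w | (X w).1 = C w] else setT.
transitivity (P' [set w | forall l, D l (Y l w)]).
  congr (P' _); apply/seteqP; split => w; rewrite /S/= tnth_lshift tnth_rshift perm1 /D/=.
    by move=> h l; case: eqP => // ->.
  by move=> /(_ i); rewrite eqxx.
rewrite PY => [|l]; last by rewrite /D; case: ifP.
by rewrite (bigD1 i)//= {1}/D eqxx PXC mul0e.
Qed.

Context (EY : forall h : T -> R, measurable_fun setT h -> (forall x, 0 <= h x) ->
  (\int[P']_w (\prod_i h (Y i w))%:E = \prod_(i < n) \int[P]_x (h x)%:E)%E).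
Context (tau s : R) (Xtau : forall w, (X w).1 <= tau).
Context (X1 : forall w, `|(X w).2| <= 1) (n0 : (0 < n)%N) (s0 : 0 < s).

Let m := fine (\int[P]_w (X w).2%:E).

(** The average over permutations is bounded pointwise by [card_ipcw_mean_deviation]. Integrating
    the moments of the uncensored mean costs [expR (s ^+ 2 / 2)] on each side, against
    [expR (- s ^+ 2)]. *)
Lemma ipcw_mean_deviation :
  (P' [set w | large_deviation tau m s
     (fun i => Num.min (X (Y i w)).1 (C (Y i w)))
     (fun i => (X (Y i w)).1 <= C (Y i w))%R (fun i => (X (Y i w)).2)]
   <= (2 * expR (- (s ^+ 2 / 2)))%:E)%E.
Proof.
pose tm (y : (n + n).-tuple (R * R)) i := (tnth y (lshift n i)).1.
pose vv (y : (n + n).-tuple (R * R)) i := (tnth y (lshift n i)).2.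
pose cc (y : (n + n).-tuple (R * R)) i := (tnth y (rshift n i)).1.
pose bad (t v c : 'I_n -> R) := large_deviation tau m s
  (fun i => Num.min (t i) (c i)) (fun i => t i <= c i) v.
pose S := [set y | bad (tm y) (vv y) (cc y)].
have mtm i : measurable_fun setT (tm ^~ i).
  exact: measurableT_comp measurable_fst (measurable_tnth _).
have mvv i : measurable_fun setT (vv ^~ i).
  exact: measurableT_comp measurable_snd (measurable_tnth _).
have mcc i : measurable_fun setT (cc ^~ i).
  exact: measurableT_comp measurable_fst (measurable_tnth _).
have mS : measurable S.
  apply: measurable_large_deviation => // i; first exact: measurable_minr.
  exact: measurable_fun_ler.
pose A p := [set w | S [tuple permuted_coord p k w | k < n + n]].
have mA p : measurable (A p).
  have mt : measurable_fun setT (fun w => [tuple permuted_coord p k w | k < n + n]).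
    apply/measurable_fun_tnthP => k.
    rewrite (_ : _ \o _ = permuted_coord p k); first exact: measurable_permuted_coord.
    by apply/funext => w /=; rewrite tnth_mktuple.
  by rewrite -[A p]setTI; exact: mt.
have AE p w : A p w = bad (fun i => (X (Y i w)).1) (fun i => (X (Y i w)).2)
    (fun i => C (Y (p i) w)) :> Prop.
  rewrite /A /S /=; set y := [tuple _ | _ < _].
  have -> : tm y = fun i => (X (Y i w)).1.
    by apply/funext => i; rewrite /tm tnth_lshift.
  have -> : vv y = fun i => (X (Y i w)).2.
    by apply/funext => i; rewrite /vv tnth_lshift.
  have -> : cc y = fun i => C (Y (p i) w).
    by apply/funext => i; rewrite /cc tnth_rshift.
  by [].
have A1E : A 1%g = [set w | bad (fun i => (X (Y i w)).1) (fun i => (X (Y i w)).2)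
    (fun i => C (Y i w))].
  apply/funext => w; rewrite AE.
  have -> : (fun i => C (Y ((1 : 'S_n)%g i) w)) = (fun i => C (Y i w)).
    by apply/funext => i; rewrite perm1.
  by [].
rewrite -[X in (P' X <= _)%E]/([set w | bad (fun i => (X (Y i w)).1)
  (fun i => (X (Y i w)).2) (fun i => C (Y i w))]) -A1E.
have [x xE] : exists x, x = s / Num.sqrt n%:R by eexists.
pose Z w := \sum_i (X (Y i w)).2 - n%:R * m.
have mX2 : measurable_fun setT (fun w => (X w).2).
  exact: measurableT_comp measurable_snd mX.
have mZ : measurable_fun setT Z.
  apply: measurable_funB; last exact: measurable_cst.
  apply: measurable_sum => i.
  exact: measurableT_comp mX2 (mY i).
have n_neq0 : n%:R != 0 :> R by rewrite pnatr_eq0 -lt0n.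
have xx : n%:R * (x ^+ 2 / 2) = s ^+ 2 / 2.
  by rewrite xE expr_div_n sqr_sqrtr ?ler0n//; field.
have [k kE] : exists k, k = n`!%:R * expR (- s ^+ 2) by eexists.
have k0 : 0 <= k by rewrite kE; apply: mulr_ge0; [exact: ler0n|exact: expR_ge0].
have IE : (\int[P']_w (k * (expR (x * Z w) + expR (- x * Z w)))%:E <=
    (2 * k * expR (s ^+ 2 / 2))%:E)%E.
  have h1 := mgf_sum_bounded x EY mX2 X1.
  have h2 := mgf_sum_bounded (- x) EY mX2 X1.
  rewrite sqrrN xx in h2; rewrite xx in h1.
  exact: (integral_two_sided_le k0 mZ h1 h2).
(* As all events [A p] have the same probability, multiplying by [n!] yields the expected number of
   permutations with a large deviation. *)
have nf0 : (0 < (n`!%:R)%:E :> \bar R)%E by rewrite lte_fin ltr0n fact_gt0.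
rewrite -(lee_pmul2l _ nf0)//.
have -> : ((n`!%:R)%:E * (2 * expR (- (s ^+ 2 / 2)))%:E =
    (2 * k * expR (s ^+ 2 / 2))%:E)%E.
  rewrite -EFinM; congr (_%:E); rewrite kE -[RHS]mulrA -[in RHS]mulrA -expRD.
  by rewrite mulrCA; congr (_ * (_ * expR _)); field.
apply: le_trans IE.
have [r rE] : exists r, P' (A 1%g) = r%:E.
  exists (fine (P' (A 1%g))); apply/esym/fineK; exact: fin_num_measure.
have PA p : P' (A p) = r%:E by rewrite -rE; exact: permuted_coord_law.
have -> : ((n`!%:R)%:E * P' (A 1%g) =
    \int[P']_w (\sum_(p <- index_enum 'S_n) \1_(A p) w)%:E)%E.
  under eq_integral do rewrite -sumEFin.
  rewrite ge0_integral_sum//.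
  + rewrite (eq_bigr (fun=> r%:E)) => [|p _].
      rewrite sumEFin sumr_const rE -EFinM mulr_natl; congr ((r *+ _)%:E).
      exact/esym/card_Sn.
    rewrite (integral_indic _ measurableT (mA p)) setIT; exact: PA.
  + by move=> p; apply/measurable_EFinP; exact: measurable_indic.
apply: ae_ge0_le_integral => //.
- by move=> w _; rewrite lee_fin sumr_ge0.
- apply/measurable_EFinP; apply: measurable_sum => p; exact: measurable_indic.
- by move=> w _; rewrite lee_fin mulr_ge0// addr_ge0// expR_ge0.
- apply/measurable_EFinP; apply: measurable_funM; first exact: measurable_cst.
  by apply: measurable_funD; apply: measurableT_comp => //; exact: measurable_funM.
(* The counting bound requires that no lifetime equal any censoring time, which holds almost surely
   only. *)
have : \forall w \ae P', forall i j, (X (Y i w)).1 != C (Y j w).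
  apply: filter_forall => i; apply: filter_forall => j.
  exists [set w | (X (Y i w)).1 = C (Y j w)]; split.
  - apply: measurable_eqr_set; last exact: measurableT_comp mC (mY j).
    exact: measurableT_comp measurable_fst (measurableT_comp mX (mY i)).
  - exact: cross_ties_negligible.
  - by move=> w /=; apply: contra_notP => /eqP.
apply: filterS => w tc _; rewrite lee_fin.
have hc := card_ipcw_mean_deviation m n0 s0 tc
  (fun i => Xtau (Y i w)) (fun i => X1 (Y i w)).
rewrite kE xE -[leRHS]mulrA; apply: le_trans hc.
rewrite le_eqVlt; apply/orP; left; apply/eqP.
rewrite -sum1_card natr_sum [RHS]big_mkcond; apply: eq_bigr => p _.
rewrite indicE inE; set b := (X in _ = if X then _ else _).
have -> : (w \in A p) = b.
  by apply/idP/idP => [/set_mem|bp]; [rewrite AE|apply/mem_set; rewrite AE].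
by case: b.
Qed.

End censored_sample.

(** * Transfer to the observed sample *)

Lemma left_lim_le (R : realType) (g : R -> R) (t b : R) : 0 <= b ->
  (forall x, g x <= b) -> left_lim g t <= b.
Proof.
move=> b0 gb; rewrite /left_lim.
have [cg|ncg] := pselect (cvg (g x @[x --> t^'-])).
  by apply: limr_le => //; exact: nearW.
(* Without a limit, [left_lim] takes the default value 0, which [0 <= b] covers. *)
by rewrite (dvgP ncg).
Qed.

Lemma eq_large_deviation (R : realType) (n : nat) (tau mu s : R)
    (u : 'I_n -> R) (delta : 'I_n -> bool) (v v' : 'I_n -> R) :
  (forall i, delta i -> v i = v' i) ->
  large_deviation tau mu s u delta v = large_deviation tau mu s u delta v'.
Proof.
move=> vv'; rewrite /large_deviation /ipcw_mean.
by congr (_ <= _ * `|_ * _ - _|); apply: eq_bigr => i di; rewrite vv'.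
Qed.

Lemma iid_copies_rect d (Omega : measurableType d) (R : realType)
    (P : probability Omega R) d1 (E : measurableType d1) (I : finType)
    (X : I -> Omega -> E) (X0 : Omega -> E) (B : I -> set E) :
  iid_copies P X X0 -> (forall i, measurable (B i)) ->
  P [set w | forall i, B i (X i w)] = (\prod_i P (X0 @^-1` B i))%E.
Proof.
move=> [indep law] mB; have := indep [set: I]%SET B mB.
rewrite (_ : \bigcap_(i in _) _ = [set w | forall i, B i (X i w)]); last first.
  by apply/seteqP; split => w h i; [apply: h => /=; rewrite inE|move=> _; exact: h].
move=> ->; rewrite (eq_bigl xpredT) => [|i]; last by rewrite inE.
by apply: eq_bigr => i _; exact: law.
Qed.

Lemma indep_pair_comp d (Omega : measurableType d) (R : realType)
    (P : probability Omega R) d1 d2 d3 (E1 : measurableType d1)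
    (E2 : measurableType d2) (E3 : measurableType d3)
    (X : Omega -> E1) (Y : Omega -> E2) (phi : E1 -> E3) :
  measurable_fun setT phi -> indep_pair P X Y -> indep_pair P (phi \o X) Y.
Proof.
move=> mphi XY A B mA mB; rewrite comp_preimage; apply: XY => //.
by rewrite -[X in measurable X]setTI; exact: mphi.
Qed.

(** Only the observations are i.i.d. copies; the joint law of [T_ i] and [C_ i] is not prescribed.
    The event, with [g] taken at the observed time, depends on the observations alone, so it can be
    moved to a product space carrying copies of [(T, Z, C)]. *)
Lemma iid_ipcw_deviation (R : realType) (d : measure_display)
    (Omega : measurableType d) (P : probability Omega R) (tau : R) (dim : nat)
    (T C : {RV P >-> R}) (Z : {RV P >-> dim.-tuple R})
    (n : nat) (T_ C_ : 'I_n -> {RV P >-> R})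
    (Z_ : 'I_n -> {RV P >-> dim.-tuple R})
    (g : R * dim.-tuple R -> R) (s : R) :
  (forall w, T w <= tau) ->
  iid_copies P (fun i => observation (T_ i) (C_ i) (Z_ i)) (observation T C Z) ->
  indep_pair P (fun w => (T w, Z w)) C ->
  P [set w | T w = C w] = 0%E ->
  measurable_fun setT g -> (forall w, `|g (T w, Z w)| <= 1) ->
  (0 < n)%N -> 0 < s ->
  (P [set w | large_deviation tau (fine (\int[P]_w (g (T w, Z w))%:E)) s
     (fun i => obs_time (T_ i) (C_ i) w) (fun i => uncensored (T_ i) (C_ i) w)
     (fun i => g (obs_time (T_ i) (C_ i) w, Z_ i w))]
   <= (2 * expR (- (s ^+ 2 / 2)))%:E)%E.
Proof.
move=> Ttau iid indep PTC mg g1 n0 s0; set m := fine _.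
have [d' [T' [P' [Y [mY PY EY]]]]] := exists_iid_copies P n.
have mobs (T0 C0 : {RV P >-> R}) (Z0 : {RV P >-> dim.-tuple R}) :
    measurable_fun setT (observation T0 C0 Z0).
  apply: measurable_fun_pair => //; apply: measurable_fun_pair.
    exact: measurable_minr.
  exact: measurable_fun_ler.
pose S := [set y : n.-tuple (R * bool * dim.-tuple R) | large_deviation tau m s
  (fun i => (tnth y i).1.1) (fun i => (tnth y i).1.2)
  (fun i => g ((tnth y i).1.1, (tnth y i).2))].
have m11 i : measurable_fun setT
    (fun y : n.-tuple (R * bool * dim.-tuple R) => (tnth y i).1.1).
  apply: measurableT_comp measurable_fst _.
  exact: measurableT_comp measurable_fst (measurable_tnth _).
have mS : measurable S.
  apply: measurable_large_deviation => // i.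
    apply: measurableT_comp mg _; apply: measurable_fun_pair => //.
    exact: measurableT_comp measurable_snd (measurable_tnth _).
  apply: measurableT_comp measurable_snd _.
  exact: measurableT_comp measurable_fst (measurable_tnth _).
have := @tuple_law_unique _ (R * bool * dim.-tuple R)%type R n _ _ _ _ P P'
  (fun i => observation (T_ i) (C_ i) (Z_ i))
  (fun i w => observation T C Z (Y i w)) _ _ _ S mS.
move=> /(_ (fun i => mobs _ _ _)).
move=> /(_ (fun i => measurableT_comp (mobs T C Z) (mY i))).
have rect B : (forall i, measurable (B i)) ->
    P [set w | forall i, B i (observation (T_ i) (C_ i) (Z_ i) w)] =
    P' [set w | forall i, B i (observation T C Z (Y i w))].
  move=> mB; rewrite (iid_copies_rect iid mB).
  pose D i := observation T C Z @^-1` B i.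
  rewrite -[RHS]/(P' [set w | forall i, D i (Y i w)]) PY// => i.
  by rewrite /D -[X in measurable X]setTI; exact: mobs.
move=> /(_ rect) law.
pose X w := (T w, g (T w, Z w)).
have mX : measurable_fun setT X.
  apply: measurable_fun_pair => //; apply: measurableT_comp mg _.
  exact: measurable_fun_pair.
have iX : indep_pair P X C.
  apply: (@indep_pair_comp _ _ _ _ _ _ _ _ _ _ _ _ (fun x => (x.1, g x))) indep.
  exact: measurable_fun_pair.
have := ipcw_mean_deviation mX (measurable_funPT C) iX mY PY PTC EY (tau := tau)
  (s := s) Ttau g1 n0 s0.
apply: le_trans; rewrite le_eqVlt; apply/orP; left; apply/eqP.
have SE (u : 'I_n -> R) (delta : 'I_n -> bool) (z : 'I_n -> dim.-tuple R) :
    S [tuple (u i, delta i, z i) | i < n] =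
    large_deviation tau m s u delta (fun i => g (u i, z i)) :> Prop.
  rewrite /S/=; set y := [tuple _ | _ < _].
  have yE i : tnth y i = (u i, delta i, z i) by rewrite tnth_mktuple.
  have -> : (fun i => (tnth y i).1.1) = u by apply/funext => i; rewrite yE.
  have -> : (fun i => (tnth y i).1.2) = delta by apply/funext => i; rewrite yE.
  by under [fun i => g _]funext => i do rewrite yE.
transitivity (P [set w | S [tuple observation (T_ i) (C_ i) (Z_ i) w | i < n]]).
  congr (P _); apply/funext => w.
  exact/esym/(SE (fun i => obs_time (T_ i) (C_ i) w)
    (fun i => uncensored (T_ i) (C_ i) w) (fun i => Z_ i w)).
rewrite law; congr (P' _); apply/funext => w.
apply: eq_trans (SE (fun i => obs_time T C (Y i w))
  (fun i => uncensored T C (Y i w)) (fun i => Z (Y i w))) _.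
(* Values enter for uncensored individuals only, and their observed time is the lifetime. *)
by congr is_true; apply: eq_large_deviation => i TC; rewrite /obs_time min_l.
Qed.

Theorem theorem2 (R : realType) :
  exists Do : R,
  forall (d : measure_display) (Omega : measurableType d)
    (P : probability Omega R)
    (tau : R) (dim : nat) (Zset : set (dim.-tuple R))
    (T C : {RV P >-> R}) (Z : {RV P >-> dim.-tuple R})
    (n : nat) (T_ C_ : 'I_n -> {RV P >-> R})
    (Z_ : 'I_n -> {RV P >-> dim.-tuple R})
    (f : R * dim.-tuple R -> R) (M eta : R),
  let H_tau := left_lim (survival P (obs_time T C)) tau in
  0 < tau ->
  (forall w, 0 <= T w <= tau) -> (forall w, 0 <= C w) ->
  (forall w, Zset (Z w)) ->
  (forall i w, 0 <= T_ i w <= tau) -> (forall i w, 0 <= C_ i w) ->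
  (forall i w, Zset (Z_ i w)) ->
  iid_copies P (fun i => observation (T_ i) (C_ i) (Z_ i))
    (observation T C Z) ->
  indep_pair P (fun w => (T w, Z w)) C ->
  0 < H_tau ->
  P [set w | T w = C w] = 0%E ->
  trace_measurable (`[0, tau] `*` Zset) f ->
  0 < M ->
  (forall x, (`[0, tau] `*` Zset) x -> `|f x| <= M) ->
  (1 <= n)%N ->
  0 < eta ->
  (P [set w |
       (3 * Num.sqrt (eta / 2) + Do / 2 <=
         Num.sqrt n%:R * H_tau * left_lim (Ghat T_ C_ w) tau / M
         * `|muhat T_ C_ Z_ f w - fine 'E_P[fun w' => f (T w', Z w')]|)%R ]
   <= (9 / 2 * expR (- eta))%:E)%E.
Proof.
exists 0 => d Omega P tau dim Zset T C Z n T_ C_ Z_ f M eta H_tau tau0 T0tau C0 Zs.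
move=> T0tau_ C0_ Zs_ iid indep H0 PTC tmf M0 fM n0 eta0.
have H1 : H_tau <= 1.
  apply: left_lim_le => // x.
  have mU : measurable [set w | x < obs_time T C w].
    rewrite -[X in measurable X]setTI.
    have : measurable_fun setT (fun w => x < obs_time T C w).
      by apply: measurable_fun_ltr => //; exact: measurable_minr.
    by move=> /(_ measurableT [set true] I).
  rewrite -lee_fin fineK; first exact: probability_le1.
  exact: fin_num_measure.
(* The extension [g] agrees with [f] at all sample points, which lie in the domain, and makes the
   values random variables. *)
have [g mg gf] := trace_measurable_extension tmf (ltW M0) fM.
have DT w : (`[0, tau] `*` Zset) (T w, Z w).
  by split => //=; rewrite in_itv/=.
pose h x := g x / M.
have mh : measurable_fun setT h by apply: measurable_funM.
have h1 w : `|h (T w, Z w)| <= 1.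
  rewrite /h gf// normrM normfV (gtr0_norm M0) ler_pdivrMr// mul1r; exact: fM.
have mTZ : measurable_fun setT (fun w => (T w, Z w)) by exact: measurable_fun_pair.
(* Dividing the threshold by [H_tau <= 1] only increases it, so [s >= 3 * sqrt (eta / 2)]. *)
pose s := 3 * Num.sqrt (eta / 2) / H_tau.
have s0 : 0 < s by rewrite divr_gt0// mulr_gt0// sqrtr_gt0 divr_gt0.
have Ttau w : T w <= tau by case/andP : (T0tau w).
have := iid_ipcw_deviation Ttau iid indep PTC mh h1 n0 s0.
set mu := fine 'E_P[_].
have -> : fine (\int[P]_w (h (T w, Z w))%:E) = mu / M.
  have fE : (fun w => f (T w, Z w)) = (fun w => g (T w, Z w)).
    by apply/funext => w; rewrite gf.
  have ig : P.-integrable setT (fun w => (g (T w, Z w))%:E).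
    apply: measurable_bounded_integrable => //.
    - by rewrite (le_lt_trans (probability_le1 _ _)) ?ltry.
    - exact: measurableT_comp mg mTZ.
    - exists M; split; first exact: num_real.
      move=> y My w _ /=; rewrite gf//; exact: le_trans (fM _ (DT w)) (ltW My).
  rewrite /mu fE unlock /h; under eq_integral do rewrite EFinM.
  by rewrite integralZr// fineM//; exact: integrable_fin_num.
move=> dev; apply: le_trans (le_trans _ dev) _.
  rewrite le_eqVlt; apply/orP; left; apply/eqP; congr (P _); apply/funext => w.
  congr is_true; rewrite /large_deviation.
  set u := fun i => _ : R; set delta := fun i => uncensored _ _ _.
  set v := fun i => h _.
  have -> : muhat T_ C_ Z_ f w = M * ipcw_mean u delta v.
    rewrite /muhat /ipcw_mean mulrCA; congr (_ * _).
    rewrite big_distrr/=; apply: eq_bigr => i di.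
    have Tu : T_ i w = u i by rewrite /u /obs_time min_l.
    rewrite -Tu /v /h -/(u i) -Tu gf; last first.
      by split => //=; rewrite in_itv/= T0tau_.
    by rewrite mulrA mulrCA divff ?mulr1// gt_eqF.
  rewrite mul0r addr0 ler_pdivrMr//; congr (_ <= _).
  have -> : M * ipcw_mean u delta v - mu = M * (ipcw_mean u delta v - mu / M).
    by field; rewrite gt_eqF.
  rewrite normrM gtr0_norm// /Ghat.
  by field; rewrite gt_eqF.
rewrite lee_fin.
(* In fact [s ^+ 2 / 2 >= 9 / 4 * eta]; the remaining slack is [2 <= 9 / 2]. *)
have es : eta <= s ^+ 2 / 2.
  have q2 : Num.sqrt (eta / 2) ^+ 2 = eta / 2 by rewrite sqr_sqrtr// divr_ge0// ltW.
  have hs : (3 * Num.sqrt (eta / 2)) ^+ 2 <= s ^+ 2.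
    rewrite ler_sqr ?nnegrE ?(ltW s0) ?mulr_ge0 ?sqrtr_ge0//.
    by rewrite ler_pdivlMr// ler_piMr// mulr_ge0 ?sqrtr_ge0.
  move: hs; rewrite exprMn q2; lra.
have e0 := expR_ge0 (- eta).
have : expR (- (s ^+ 2 / 2)) <= expR (- eta) by rewrite ler_expR lerN2.
lra.
Qed.
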